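(* The bivariate generating function $f^H(x,y)=\sum_{n,k\ge0}h_{n,k}x^ky^n$, where $h_{n,k}$ is the number of $k$-dimensional faces of the $n$-dimensional halohedron, is \[ f^H(x,y)=\frac{1+(2+x)y}{2\sqrt{1-2(2+x)y+x^2y^2}}+\frac12 . \]
   Context: Let $\pm[n]=\{-n,\dots,-1,1,\dots,n\}$. The single cycle hypercube graph is the graph on $\pm[n]$ with edges $\{i,i+1\}$ for $1\le i<n$ and $\{1,n\}$, and no others (so for $n=2$ there is the single edge $\{1,2\}$, and for $n=1$ no edge). A tube is a nonempty subset of $\pm[n]$ inducing a connected subgraph and containing no pair $\{i,-i\}$. Two tubes are weakly compatible if one is contained in the other, or they are disjoint with no edge between them. A tubing is a set of pairwise weakly compatible tubes whose union contains no pair $\{i,-i\}$. The $n$-dimensional halohedron (the cubeahedron of the cycle graph on $n$ vertices) is the simple $n$-dimensional polytope whose dual simplicial complex (sets of facets with nonempty intersection) is isomorphic to the complex of tubings of the single cycle hypercube graph; thus its $k$-dimensional faces correspond to tubings with $n-k$ tubes. For $n=0$ it is a point. The empty face is not counted. The square root denotes the formal power series with constant term $1$. *)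

(* Defs.v *)
From HB Require Import structures.
From mathcomp Require Import all_boot all_order all_algebra finmap.
From mathcomp Require Import all_classical reals.

Set Implicit Arguments.
Unset Strict Implicit.
Unset Printing Implicit Defensive.

Import Order.TTheory GRing.Theory Num.Theory.

Local Open Scope classical_set_scope.
Local Open Scope ring_scope.

(* A record rather than an alias of [nat -> R], because MathComp-Analysis
   already gives [nat -> R] the pointwise product. *)
Record fps (R : Type) := FPS { coefps : nat -> R }.

HB.instance Definition _ (R : Type) := gen_eqMixin (fps R).
HB.instance Definition _ (R : Type) := gen_choiceMixin (fps R).

Lemma fpsP (R : Type) (f g : fps R) : coefps f =1 coefps g -> f = g.
Proof. by case: f => f; case: g => g /= /funext ->. Qed.

Section FpsRing.
Variable R : comNzRingType.
Implicit Types f g h : fps R.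

Definition fpsC (c : R) : fps R := FPS (fun n => if n == 0%N then c else 0).
Definition fpsX : fps R := FPS (fun n => (n == 1%N)%:R).

Definition fps_add f g := FPS (fun n => coefps f n + coefps g n).
Definition fps_opp f := FPS (fun n => - coefps f n).
Definition fps_mul f g :=
  FPS (fun n => \sum_(i < n.+1) coefps f i * coefps g (n - i)).

Fact fps_addA : associative fps_add.
Proof. by move=> f g h; apply/fpsP => n /=; rewrite addrA. Qed.
Fact fps_addC : commutative fps_add.
Proof. by move=> f g; apply/fpsP => n /=; rewrite addrC. Qed.
Fact fps_add0 : left_id (fpsC 0) fps_add.
Proof. by move=> f; apply/fpsP => n /=; rewrite if_same add0r. Qed.
Fact fps_addN : left_inverse (fpsC 0) fps_opp fps_add.
Proof. by move=> f; apply/fpsP => n /=; rewrite if_same addNr. Qed.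

HB.instance Definition _ :=
  GRing.isZmodule.Build (fps R) fps_addA fps_addC fps_add0 fps_addN.

Let trunc N f : {poly R} := \poly_(i < N) coefps f i.

Let coef_trunc_mul N f g n : (n < N)%N ->
  (trunc N f * trunc N g)`_n = coefps (fps_mul f g) n.
Proof.
move=> ltnN; rewrite coefM; apply: eq_bigr => i _; rewrite !coef_poly.
by rewrite (leq_ltn_trans (leq_ord i) ltnN) (leq_ltn_trans (leq_subr i n) ltnN).
Qed.

Fact fps_mulA : associative fps_mul.
Proof.
move=> f g h; apply/fpsP => n.
transitivity ((trunc n.+1 f * (trunc n.+1 g * trunc n.+1 h))`_n).
  rewrite coefM; apply: eq_bigr => i _.
  by rewrite coef_trunc_mul ?ltnS ?leq_subr // coef_poly ltn_ord.
rewrite mulrA coefM; apply: eq_bigr => i _.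
by rewrite coef_trunc_mul // coef_poly ltnS leq_subr.
Qed.

Fact fps_mulC : commutative fps_mul.
Proof.
move=> f g; apply/fpsP => n.
by rewrite -!(@coef_trunc_mul n.+1) // mulrC.
Qed.

Fact fps_mul1 : left_id (fpsC 1) fps_mul.
Proof.
move=> f; apply/fpsP => n /=.
by rewrite big_ord_recl /= mul1r subn0 big1 ?addr0 // => i _; rewrite mul0r.
Qed.

Fact fps_mulDl : left_distributive fps_mul fps_add.
Proof.
move=> f g h; apply/fpsP => n /=.
by rewrite -big_split /=; apply: eq_bigr => i _; rewrite mulrDl.
Qed.

Fact fps_one_neq0 : fpsC 1 != 0.
Proof.
apply/eqP => /(congr1 (fun f => coefps f 0)) /= /eqP.
by rewrite oner_eq0.
Qed.

HB.instance Definition _ := GRing.Zmodule_isComNzRing.Build (fps R)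
  fps_mulA fps_mulC fps_mul1 fps_mulDl fps_one_neq0.

Definition fps_unit : pred (fps R) := fun f => `[< exists g, g * f = 1 >].
Definition fps_inv f : fps R := xget f [set g | g * f = 1].

Fact fps_mulVf : {in fps_unit, left_inverse 1 fps_inv *%R}.
Proof. by move=> f /asboolP[g gf1]; rewrite /fps_inv; case: xgetP => [//|/(_ g)]. Qed.

Fact fps_unitP f g : g * f = 1 -> fps_unit f.
Proof. by move=> gf1; apply/asboolP; exists g. Qed.

Fact fps_inv_out : {in [predC fps_unit], fps_inv =1 id}.
Proof.
move=> f /negP nuf; rewrite /fps_inv; case: xgetP => [g _ gf1|//].
by case: nuf; apply: fps_unitP gf1.
Qed.

HB.instance Definition _ := GRing.ComNzRing_hasMulInverse.Build (fps R)
  fps_mulVf fps_unitP fps_inv_out.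

End FpsRing.

(* Q[[x, y]] as Q[[x]][[y]]: the coefficient of x^k y^n in [f] is
   [coefps (coefps f n) k]. *)
Definition fps2 := fps (fps rat).

Definition fps2_of (a : nat -> nat -> rat) : fps2 :=
  FPS (fun n => FPS (fun k => a n k)).

Definition varx : fps2 := fpsC (fpsX rat).
Definition vary : fps2 := fpsX (fps rat).

(* The square root with constant term 1 (and 0 if there is none). *)
Definition fps2_sqrt (f : fps2) : fps2 :=
  xget 0 [set g : fps2 | g ^+ 2 = f /\ coefps (coefps g 0) 0 = 1].

(* A simplicial complex is given by its set of simplices. *)
Definition vertices (T : Type) (K : set (set T)) : set T := [set v | K [set v]].

Definition complex_iso (T U : Type) (K : set (set T)) (L : set (set U)) : Prop :=
  exists f : T -> U, set_bij (vertices K) (vertices L) f /\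
    forall S : set T, S `<=` vertices K -> (K S <-> L (f @` S)).

Section Polytopes.
Variables (R : realType) (d : nat).
Implicit Types (P F G : set 'rV[R]_d).

Definition is_polytope P : Prop :=
  (exists m (A : 'M[R]_(d, m)) (b : 'rV[R]_m),
     P = [set x | forall j, (x *m A) 0 j <= b 0 j]) /\
  (exists M : R, forall x, P x -> forall i, `|x 0 i| <= M).

(* The affine hull has dimension k: it is spanned by k + 1 affinely independent
   points x0, x0 + row 0 V, ..., x0 + row (k-1) V of the set. *)
Definition has_dim (k : nat) P : Prop :=
  exists (x0 : 'rV[R]_d) (V : 'M[R]_(k, d)),
    [/\ P x0, row_free V, forall i, P (x0 + row i V)
      & forall x, P x -> (x - x0 <= V)%MS].

(* Nonempty faces, including P itself (take c = 0). *)
Definition is_face P F : Prop :=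
  F !=set0 /\ exists c : 'cV[R]_d,
    F = [set x | P x /\ forall y, P y -> (y *m c) 0 0 <= (x *m c) 0 0].

Definition faces P (k : nat) : set (set 'rV[R]_d) :=
  [set F | is_face P F /\ has_dim k F].

Definition nb_faces P (k : nat) : nat := #|` fset_set (faces P k) |%fset.

Definition facets P : set (set 'rV[R]_d) :=
  [set F | exists k, has_dim k.+1 P /\ faces P k F].

Definition simple_polytope P : Prop :=
  is_polytope P /\ forall n, has_dim n P -> forall F, faces P 0 F ->
    ([set G | facets P G /\ F `<=` G] #= `I_n)%card.

(* P is there for S = set0, which is a simplex. *)
Definition dual_complex P : set (set (set 'rV[R]_d)) :=
  [set S | S `<=` facets P /\ P `&` \bigcap_(F in S) F !=set0].

End Polytopes.

(* ±[n]: [(i, true)] stands for i + 1 and [(i, false)] for - (i + 1). *)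
Definition pmn (n : nat) : finType := ('I_n * bool)%type.

Definition antipode (n : nat) (u : pmn n) : pmn n := (u.1, ~~ u.2).

Definition adj (n : nat) : rel (pmn n) := fun u v =>
  [&& u.2, v.2, u != v &
   [|| u.1.+1 == v.1 :> nat, v.1.+1 == u.1 :> nat,
       (u.1 == 0 :> nat) && (v.1.+1 == n) |
       (v.1 == 0 :> nat) && (u.1.+1 == n)]].

Definition connected_in (n : nat) (t : {set pmn n}) : bool :=
  [forall u in t, forall v in t,
    connect [rel a b | [&& a \in t, b \in t & adj a b]] u v].

Definition tube (n : nat) (t : {set pmn n}) : bool :=
  [&& t != finset.set0, connected_in t & [forall u in t, antipode u \notin t]].

Definition weakly_compatible (n : nat) (s t : {set pmn n}) : bool :=
  [|| s \subset t, t \subset s |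
   [disjoint s & t] && [forall u in s, forall v in t, ~~ adj u v]].

Definition tubings (n : nat) : set (set {set pmn n}) :=
  [set T | [/\ forall t, T t -> tube t,
               forall s t, T s -> T t -> weakly_compatible s t
             & forall s t u, T s -> T t -> u \in s -> antipode u \notin t]].

Definition is_halohedron (R : realType) (d n : nat) (P : set 'rV[R]_d) : Prop :=
  [/\ has_dim n P, simple_polytope P & complex_iso (dual_complex P) (@tubings n)].

(* Main.v *)
(* Let z mark tubes. Splitting tubings by the maximal tube containing a fixed
   vertex gives, for every vertex set X and v in X,
     wt X = wt (X - v) + sum over the tubes M with v in M <= X of
                           z * wt0 M * wt (X minus M, its neighbours and -M),
   where wt0 M counts the tubings inside M that do not contain M, so that
   wt M = (1 + z) wt0 M. On arcs of a cycle this yields convolution recursions.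
   With u = y Q, where Q counts the maximal tubes or empty gaps between uncovered
   vertices, they become u (1 - (1 + z) u) = y (1 - u), and hence the generating
   function S of all tubings satisfies 2 r S = r + 1 + (1 + 2z) y, where
   r = 1 + y - 2 (1 + z) u satisfies r^2 = 1 - 2 (1 + 2z) y + y^2. Substituting
   1/x for z and x y for y gives the formula.

   On the geometric side, a polytope is described by an irredundant system of
   inequalities, whose members correspond to the facets. Simplicity makes the n
   inequalities tight at a vertex independent on the affine hull, so every set of
   facets with a common point cuts out a face whose codimension is its size, every
   face arises in this way, and it determines the set. *)
Require Import Defs.
From mathcomp Require Import all_boot all_order all_algebra ring lra zify.

Set Implicit Arguments.
Unset Strict Implicit.
Unset Printing Implicit Defensive.

Import Order.TTheory GRing.Theory Num.Theory.
Local Open Scope ring_scope.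

(** * Weighted counts of tubings *)

Section Tubings.
Variable n : nat.
Implicit Types (u v : pmn n) (s t M X : {set pmn n}) (T : {set {set pmn n}}).

(** Antipodes conflict just as neighbours do, so the condition on the union of a tubing becomes one
    on pairs of tubes. The reflexive case makes overlapping tubes conflict too. *)
Definition clash : rel (pmn n) :=
  fun u v => [|| v == u, adj u v | v == antipode u].

Definition nbhd M : {set pmn n} := [set v | [exists u in M, clash u v]].

Definition nested_or_far s t := [|| s \subset t, t \subset s | [disjoint nbhd s & t]].

Definition tubings_in X : {set {set {set pmn n}}} :=
  [set T : {set {set pmn n}} | [forall t in T, tube t && (t \subset X)] &&
           [forall s in T, forall t in T, nested_or_far s t]].

Lemma adj_sym : symmetric (@adj n).
Proof.
move=> u v; rewrite /adj [v == u]eq_sym.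
case: u.2; case: v.2 => //=; case: (u != v) => //=.
by rewrite orbCA; do 2 congr orb; rewrite orbC.
Qed.

Lemma antipodeK : involutive (@antipode n).
Proof. by case=> i b; rewrite /antipode /= negbK. Qed.

Lemma clash_sym : symmetric clash.
Proof.
move=> u v; rewrite /clash [v == u]eq_sym adj_sym; do 2 congr orb.
by rewrite (eq_sym u) (can2_eq antipodeK antipodeK).
Qed.

Lemma nbhdP M v : reflect (exists2 u, u \in M & clash u v) (v \in nbhd M).
Proof. by rewrite inE; apply: (iffP exists_inP). Qed.

Lemma sub_nbhd M : M \subset nbhd M.
Proof. by apply/subsetP => u uM; apply/nbhdP; exists u; rewrite // /clash eqxx. Qed.

Lemma farP s t :
  reflect (forall u v, u \in s -> v \in t -> ~~ clash u v) [disjoint nbhd s & t].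
Proof.
rewrite disjoints_subset; apply: (iffP subsetP) => [st u v us vt | st v /nbhdP[u us uv]].
  by apply: contraL vt => uv; rewrite -in_setC st //; apply/nbhdP; exists u.
by rewrite inE; apply: contraL uv; exact: st.
Qed.

Lemma far_sym s t : [disjoint nbhd s & t] = [disjoint nbhd t & s].
Proof. by apply/farP/farP => H u v us vt; rewrite clash_sym H. Qed.

Lemma tubings_inP X T :
  reflect [/\ forall t, t \in T -> tube t, forall t, t \in T -> t \subset X
            & forall s t, s \in T -> t \in T -> nested_or_far s t]
          (T \in tubings_in X).
Proof.
rewrite inE; apply: (iffP andP) => [[/forall_inP tX /forall_inP c] | [tT tX c]].
  split=> [t /tX/andP[]//|t /tX/andP[]//|s t sT tT].
  by move/forall_inP: (c s sT); apply.
split; apply/forall_inP => t tinT; first by rewrite tT ?tX.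
by apply/forall_inP => s sT; apply: c.
Qed.

Lemma tube_neq0 t : tube t -> t != set0.
Proof. by case/and3P. Qed.

Lemma tubings_in_uncovered v X T :
  (T \in tubings_in (X :\ v)) = (T \in tubings_in X) && (v \notin cover T).
Proof.
apply/tubings_inP/andP => [[tT tX c] | [/tubings_inP[tT tX c] vT]].
  split; first by apply/tubings_inP; split=> // t /tX; rewrite subsetD1 => /andP[].
  by apply/bigcupP => -[t /tX]; rewrite subsetD1 => /andP[_ /negP].
split=> // t tinT; rewrite subsetD1 tX //=.
by apply: contra vT => vt; apply/bigcupP; exists t.
Qed.

(* For a tubing [T] covering [v] this union is its largest tube containing [v]. *)
Definition top v T : {set pmn n} := \bigcup_(t in T | v \in t) t.

(** Two tubes that share [v] cannot be far apart, so the tubes of [T] through [v] form a chain, and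
    one of maximal cardinality contains all the others. *)
Lemma top_mem v X T : T \in tubings_in X -> v \in cover T -> top v T \in T.
Proof.
case/tubings_inP => tT tX c /bigcupP[t0 t0T vt0].
pose Q := [pred t | (t \in T) && (v \in t)].
have Qt0 : Q t0 by rewrite /= t0T.
case: (@arg_maxnP _ t0 Q (fun t : {set pmn n} => #|t|) Qt0) => t /andP[/= tinT vt] tmax.
suff -> : top v T = t by [].
apply/eqP; rewrite eqEsubset (bigcup_sup t) ?tinT // andbT.
apply/bigcupsP => s /andP[sT vs].
case/or3P: (c s t sT tinT) => // [ts|/farP/(_ v v vs vt)]; last by rewrite /clash eqxx.
by have /eqP<- : t == s by rewrite eqEcard ts tmax //= sT.
Qed.

Lemma top_sub v T t : t \in T -> v \in t -> t \subset top v T.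
Proof. by move=> tT vt; rewrite (bigcup_sup t) ?tT. Qed.

Definition wt X : {poly rat} := \sum_(T in tubings_in X) 'X^#|T|.
Definition wt0 M : {poly rat} := \sum_(T in tubings_in M | M \notin T) 'X^#|T|.

(** [M] is nested with every tube inside it, so it can be added to or removed from any tubing of
    [M]. *)
Lemma wt_tube M : tube M -> wt M = (1 + 'X) * wt0 M.
Proof.
move=> tM; rewrite /wt (bigID (fun T : {set {set pmn n}} => M \notin T)) /= mulrDl mul1r.
congr (_ + _).
rewrite (reindex_onto (fun T => M |: T) (fun T => T :\ M)) /=; last first.
  by move=> T /andP[_ /negPn MT]; rewrite setD1K.
rewrite /wt0 mulr_sumr; apply: eq_big => [T | T /andP[_ /eqP TM]].
  rewrite setU11 /= andbT; apply/andP/andP =>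
    [[/tubings_inP[tT TX c] /eqP eT] | [/tubings_inP[tT TX c] nMT]].
    rewrite -eT setD11; split=> //; apply/tubings_inP; split=> [t|t|s t].
    - by rewrite in_setD1 => /andP[_]; exact: tT.
    - by rewrite in_setD1 => /andP[_]; exact: TX.
    - by rewrite !in_setD1 => /andP[_ ?] /andP[_ ?]; exact: c.
  rewrite setU1K //; split=> //; apply/tubings_inP; split=> [t|t|s t].
  - by case/setU1P => [->//|]; exact: tT.
  - by case/setU1P => [->//|]; exact: TX.
  - case/setU1P => [->|sT] /setU1P[->|tT']; rewrite /nested_or_far ?subxx //.
    + by rewrite (TX t tT') orbT.
    + by rewrite (TX s sT).
    + exact: c.
by rewrite cardsU1 -{1}TM setD11 /= exprS.
Qed.

Lemma wt_set0 : wt set0 = 1.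
Proof.
rewrite /wt (big_pred1 set0) ?cards0 // => T; apply/tubings_inP/eqP => [[tT T0 _]|->].
  apply/setP => t; rewrite inE; apply/negP => tinT.
  by have := tube_neq0 (tT t tinT); rewrite -subset0 T0.
by split=> [t|t|s t]; rewrite inE.
Qed.

(** Apart from [M], each tube of such a tubing lies properly inside [M] or is far from it: one
    containing [M] would contain [v] and so lie in [top v T]. The two families vary independently,
    which gives the product. *)
Lemma wt_top v X M : tube M -> M \subset X -> v \in M ->
  \sum_(T in tubings_in X | (v \in cover T) && (top v T == M)) 'X^#|T|
    = 'X * wt0 M * wt (X :\: nbhd M) :> {poly rat}.
Proof.
move=> tM MX vM; rewrite -mulrA /wt0 /wt big_distrlr /= mulr_sumr.
under [RHS]eq_bigr do rewrite mulr_sumr.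
rewrite pair_big /=.
have M0 : [disjoint nbhd M & M] = false.
  by apply/negP => /farP/(_ v v vM vM); rewrite /clash eqxx.
rewrite (reindex_onto (fun p : {set {set pmn n}} * {set {set pmn n}} => M |: (p.1 :|: p.2))
   (fun T => ([set t in T | t \proper M], [set t in T | [disjoint nbhd M & t]]))) /=;
  last first.
  move=> T /and3P[TX vT /eqP topT]; have MT : M \in T by rewrite -topT (top_mem TX).
  apply/setP => t; rewrite !inE; apply/idP/idP => [/or3P[/eqP->//|/andP[]//|/andP[]//]|tT].
  rewrite tT /=; have [//|tnM /=] := eqVneq t M.
  case/tubings_inP: TX => _ _ /(_ M t MT tT)/or3P[Mt|tsM|->]; last by rewrite orbT.
    by case/eqP: tnM; apply/eqP; rewrite eqEsubset Mt -topT top_sub // (subsetP Mt).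
  by rewrite properEneq tnM tsM.
have split_mem (T1 T2 : {set {set pmn n}}) :
    ([set t in M |: (T1 :|: T2) | t \proper M],
     [set t in M |: (T1 :|: T2) | [disjoint nbhd M & t]]) = (T1, T2) ->
    (forall t, t \in T1 -> t \proper M) /\ (forall t, t \in T2 -> [disjoint nbhd M & t]).
  by case=> e1 e2; split=> t; rewrite -1?e1 -1?e2 inE => /andP[].
have far12 s t : s \subset M -> [disjoint nbhd M & t] -> [disjoint nbhd s & t].
  by move=> sM /farP h; apply/farP => u w us wt; apply: h => //; apply: (subsetP sM).
have no_both t : tube t -> t \proper M -> [disjoint nbhd M & t] -> False.
  move=> /tube_neq0/set0Pn[w wt] /proper_sub/subsetP/(_ w wt) wM /farP/(_ w w wM wt).
  by rewrite /clash eqxx.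
apply: eq_big => [[T1 T2]|[T1 T2] /andP[/and3P[TX _ _] /eqP/split_mem[T1M T2M]]] /=;
  last first.
  rewrite cardsU1 cardsU -!exprD.
  have -> : T1 :&: T2 = set0.
    apply/setP => t; rewrite !inE; apply/andP => -[tT1 tT2].
    case/tubings_inP: TX => tT _ _; apply: (no_both t) (T1M _ tT1) (T2M _ tT2).
    by apply: tT; rewrite !inE tT1 orbT.
  have -> : M \notin T1 :|: T2.
    by rewrite inE; apply/negP => /orP[/T1M|/T2M]; rewrite ?M0 ?properxx.
  by rewrite cards0 subn0 -exprS.
apply/andP/andP =>
  [[/and3P[TX vT /eqP topT] /eqP eT] | [/andP[/tubings_inP[tT1 T1M c1] MT1] T2X]].
  have [T1M T2M] := split_mem _ _ eT; case/tubings_inP: TX => tT TX c.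
  have inl t : t \in T1 -> t \in M |: (T1 :|: T2) by move=> h; rewrite !inE h !orbT.
  have inr t : t \in T2 -> t \in M |: (T1 :|: T2) by move=> h; rewrite !inE h !orbT.
  split; last first.
    apply/tubings_inP; split=> [t /inr/tT//|t tT2|s t sT tT']; last by apply: c; apply: inr.
    by rewrite subsetD TX ?inr //= disjoint_sym T2M.
  apply/andP; split; last by apply/negP => /T1M; rewrite properxx.
  apply/tubings_inP; split=> [t /inl/tT//|t /T1M/proper_sub//|s t sT tT'].
  by apply: c; apply: inl.
case/tubings_inP: T2X => tT2 T2X c2.
have T2M t : t \in T2 -> [disjoint nbhd M & t].
  by move/T2X; rewrite subsetD disjoint_sym => /andP[].
have tT t : t \in M |: (T1 :|: T2) -> tube t.
  by rewrite !inE => /or3P[/eqP->//|/tT1//|/tT2//].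
have T1pM t : t \in T1 -> t \proper M.
  by move=> tT1'; rewrite properEneq T1M // andbT; apply: contraNneq MT1 => <-.
have TX : M |: (T1 :|: T2) \in tubings_in X.
  apply/tubings_inP; split=> // [t|s t].
    rewrite !inE => /or3P[/eqP->//|/T1M tM1|/T2X]; first exact: subset_trans MX.
    by rewrite subsetD => /andP[].
  rewrite !inE => /or3P[/eqP->|sT|sT] /or3P[/eqP->|tT'|tT'].
  - by rewrite /nested_or_far subxx.
  - by rewrite /nested_or_far (T1M t) ?orbT.
  - by rewrite /nested_or_far (T2M t) ?orbT.
  - by rewrite /nested_or_far (T1M s).
  - exact: c1.
  - by rewrite /nested_or_far (far12 s t) ?orbT ?T1M ?T2M.
  - by rewrite /nested_or_far far_sym (T2M s) ?orbT.
  - by rewrite /nested_or_far far_sym (far12 t s) ?orbT ?T1M ?T2M.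
  - exact: c2.
have vcov : v \in cover (M |: (T1 :|: T2)).
  by apply/bigcupP; exists M; rewrite ?setU11.
split; last first.
  apply/eqP; congr (_, _); apply/setP => t; rewrite !inE.
    apply/andP/idP => [[/or3P[/eqP->|//|tT2'] pt]|tT1']; last by rewrite tT1' orbT T1pM.
      by rewrite properxx in pt.
    by case: (no_both t (tT2 t tT2') pt (T2M t tT2')).
  apply/andP/idP => [[/or3P[/eqP->|tT1'|//] dt]|tT2']; last by rewrite tT2' !orbT T2M.
    by rewrite M0 in dt.
  by case: (no_both t (tT1 t tT1') (T1pM t tT1') dt).
rewrite TX vcov /=; rewrite eqEsubset top_sub ?setU11 // andbT.
apply/bigcupsP => t /andP[]; rewrite !inE => /or3P[/eqP->//|/T1M//|/T2M /farP far] vt.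
by have := far v v vM vt; rewrite /clash eqxx.
Qed.

Lemma wt_rec v X : v \in X ->
  wt X = wt (X :\ v)
    + \sum_(M : {set pmn n} | [&& tube M, M \subset X & v \in M])
         'X * wt0 M * wt (X :\: nbhd M).
Proof.
move=> vX; rewrite {1}/wt (bigID (fun T : {set {set pmn n}} => v \notin cover T)) /=.
congr (_ + _).
  by apply: eq_bigl => T; rewrite tubings_in_uncovered.
rewrite (partition_big (top v) [pred M | [&& tube M, M \subset X & v \in M]]) /=.
  apply: eq_bigr => M /and3P[tM MX vM]; rewrite -(wt_top tM MX vM).
  by apply: eq_bigl => T; rewrite negbK andbA.
move=> T /andP[TX /negPn vT]; have topT := top_mem TX vT.
case/tubings_inP: TX => tT TX _; rewrite tT // TX //=.
by case/bigcupP: vT => t tinT vt; apply: (subsetP (top_sub tinT vt)).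
Qed.
End Tubings.

(** * Arcs of the cycle *)

Section Arcs.
Variable n : nat.
Implicit Types (a i j : 'I_n.+1) (u v : pmn n.+1) (M X : {set pmn n.+1}).

(* The number of steps from [a] to [u.1] around the cycle: ['I_n.+1] is Z/(n+1). *)
Definition pos a u : nat := (u.1 - a)%R.
Definition cycarc a l : {set pmn n.+1} := [set u : pmn n.+1 | u.2 && (pos a u < l)%N].
Definition dblarc a l : {set pmn n.+1} := [set u : pmn n.+1 | (pos a u < l)%N].

Lemma modS k : (k < n.+1)%N -> (k.+1 %% n.+1 = if k == n then 0 else k.+1)%N.
Proof.
by move=> kn; case: eqP => [->|k_n]; [rewrite modnn | rewrite modn_small //; lia].
Qed.

Lemma adjE u v : adj u v =
  [&& u.2, v.2, u != v & (v.1 == u.1 + inZp 1) || (u.1 == v.1 + inZp 1)].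
Proof.
rewrite /adj; change (0%R : nat) with 0%N; do 3 congr andb.
case: u v => [[i hi] b] [[j hj] c].
rewrite -!val_eqE /= !modnDmr !addn1 !modS //.
by case: (i =P n); case: (j =P n) => ? ?; lia.
Qed.

(** Adjacency is invariant under rotation, so positions relative to any base [a] determine it; the
    last two disjuncts are the edge that closes the cycle. *)
Lemma adj_pos a u v : adj u v =
  [&& u.2, v.2, pos a u != pos a v &
   [|| pos a v == (pos a u).+1, pos a u == (pos a v).+1,
     (pos a u == 0%N) && (pos a v == n) | (pos a v == 0%N) && (pos a u == n)]].
Proof.
transitivity (adj (u.1 - a, u.2) (v.1 - a, v.2)).
  rewrite !adjE /= !xpair_eqE (inj_eq (addIr _)) -!(addrAC _ _ (- a)) !(inj_eq (addIr _)).
  by case: u v => [? ?] [? ?] /=; rewrite xpair_eqE.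
rewrite /pos; move: (u.1 - a) (v.1 - a) u.2 v.2 => [x hx] [y hy] [] [] //=.
rewrite /adj xpair_eqE -val_eqE /= andbT; change (0%R : nat) with 0%N.
by case: (x =P y) => //=; lia.
Qed.

Lemma ltn_pos a u : (pos a u <= n)%N.
Proof. by rewrite -ltnS /pos. Qed.

Definition vx a k : pmn n.+1 := (a + inZp k, true).

Lemma pos_vx a k : (k <= n)%N -> pos a (vx a k) = k.
Proof.
move=> kn; have -> : pos a (vx a k) = (inZp k : 'I_n.+1) by rewrite /pos addrAC subrr add0r.
by rewrite /= modn_small.
Qed.

Lemma vx_pos a u : u.2 -> vx a (pos a u) = u.
Proof.
case: u => i b; rewrite [(i, b).2]/= => ->; congr (_, _).
suff -> : inZp (pos a (i, true)) = i - a by rewrite addrC subrK.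
by apply: val_inj; rewrite [val (inZp _)]/= modn_small // ltn_ord.
Qed.

Lemma pos_inj a u v : u.2 = v.2 -> pos a u = pos a v -> u = v.
Proof.
by case: u v => [i b] [j c]; rewrite [(i, b).2]/= => -> /val_inj/addIr /= ->.
Qed.

Lemma pos_shift a u s : (s <= n)%N ->
  pos (a + inZp s) u = if (s <= pos a u)%N then (pos a u - s)%N else (pos a u + n.+1 - s)%N.
Proof.
move=> sn; rewrite /pos opprD addrA.
case: (u.1 - a) => x xn; rewrite /= (@modn_small s) //.
have [s0|s_gt0] := posnP s; first by rewrite s0 subn0 modnn addn0 modn_small // subn0.
rewrite (@modn_small (n.+1 - s)); last by lia.
have [sx|xs] := leqP s x; last by rewrite modn_small; lia.
have -> : (x + (n.+1 - s) = x - s + n.+1)%N by lia.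
by rewrite modnDr modn_small; lia.
Qed.

Lemma in_cycarc a l u : (u \in cycarc a l) = u.2 && (pos a u < l)%N.
Proof. by rewrite inE. Qed.

Lemma in_dblarc a l u : (u \in dblarc a l) = (pos a u < l)%N.
Proof. by rewrite inE. Qed.

Lemma in_cycarc_shift a s l u : (s <= n)%N -> (s + l <= n.+1)%N ->
  (u \in cycarc (a + inZp s) l) = [&& u.2, (s <= pos a u)%N & (pos a u < s + l)%N].
Proof.
move=> sn sl; rewrite in_cycarc pos_shift //; have := ltn_pos a u.
by case: (leqP s (pos a u)) => ? ?; case: u.2 => //=; lia.
Qed.

Lemma in_dblarc_shift a s l u : (s <= n)%N -> (s + l <= n.+1)%N ->
  (u \in dblarc (a + inZp s) l) = (s <= pos a u)%N && (pos a u < s + l)%N.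
Proof.
move=> sn sl; rewrite in_dblarc pos_shift //; have := ltn_pos a u.
by case: (leqP s (pos a u)) => ? ?; lia.
Qed.

Lemma induced_connect_sym M : connect_sym [rel x y | [&& x \in M, y \in M & adj x y]].
Proof. by apply: sym_connect_sym => x y /=; rewrite adj_sym andbCA. Qed.

(** Connectivity as an induction principle along the edges inside [M], used to classify the
    tubes. *)
Lemma tube_ind (B : pred (pmn n.+1)) M u : tube M -> u \in M -> B u ->
  (forall x y, x \in M -> y \in M -> adj x y -> B x -> B y) ->
  forall v, v \in M -> B v.
Proof.
case/and3P => _ /forall_inP/(_ u) cM _ uM Bu step v vM.
have /forall_inP/(_ v vM) uv := cM uM.
have cl := intro_closed (a := B) (induced_connect_sym M).
have /(_ _ _ _ uv) := closed_connect (cl _); rewrite !unfold_in => <- // x y.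
by case/and3P => *; rewrite unfold_in (step x y).
Qed.

Lemma tube_positive M u : tube M -> u \in M -> u.2 -> forall v, v \in M -> v.2.
Proof.
move=> tM uM u2; apply: (@tube_ind (fun w => w.2) M u) => // x y _ _.
by case/and4P.
Qed.

Lemma tube_arc a l : (0 < l <= n.+1)%N -> tube (cycarc a l).
Proof.
case/andP=> l_gt0 ln; apply/and3P; split.
- by apply/set0Pn; exists (vx a 0); rewrite in_cycarc pos_vx.
- pose e := [rel x y | [&& x \in cycarc a l, y \in cycarc a l & adj x y]].
  have from0 k : (k < l)%N -> connect e (vx a 0) (vx a k).
    elim: k => [|k IHk] kl; first exact: connect0.
    apply: connect_trans (IHk (ltnW kl)) _; apply: connect1.
    by rewrite /= !in_cycarc (adj_pos a) !pos_vx /= ?eqxx; lia.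
  apply/forall_inP => u; rewrite in_cycarc => /andP[u2 ul].
  apply/forall_inP => v; rewrite in_cycarc => /andP[v2 vl].
  rewrite -(vx_pos a u2) -(vx_pos a v2).
  by apply: connect_trans (from0 _ vl); rewrite induced_connect_sym; exact: from0.
by apply/forall_inP => u; rewrite !in_cycarc => /andP[/= ->].
Qed.

(** As [l <= n], no vertex of [M] has position [n], so the closing edge of the cycle is out of
    reach. By connectivity nothing beyond the first missing position can then belong to [M]. *)
Lemma tube_arcP a l M : (l <= n)%N -> tube M -> M \subset dblarc a l -> vx a 0 \in M ->
  exists2 m, (m < l)%N & M = cycarc a m.+1.
Proof.
move=> ln tM Ml aM; have Mpos := tube_positive tM aM isT.
have lM : vx a l \notin M.
  by apply/negP => /(subsetP Ml); rewrite in_dblarc pos_vx ?ltnn.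
have exm : exists m, vx a m \notin M by exists l.
case: (ex_minnP exm) => -[|m] mM m_min; first by rewrite aM in mM.
have arcM k : (k < m.+1)%N -> vx a k \in M.
  by move=> km; apply: contraTT km => /m_min; rewrite -leqNgt.
have ml : (m < l)%N := m_min l lM.
exists m => //; apply/eqP; rewrite eqEsubset; apply/andP; split; last first.
  by apply/subsetP => u; rewrite in_cycarc => /andP[u2 um]; rewrite -(vx_pos a u2) arcM.
apply/subsetP; apply: (@tube_ind (fun u => u \in cycarc a m.+1) M (vx a 0)) => // [|x y xM yM].
  by rewrite in_cycarc pos_vx.
(* An edge leaving the arc would have to end at the missing position [m.+1]. *)
have ym : pos a y != m.+1.
  by apply: contraNneq mM => <-; rewrite vx_pos // Mpos.
have := subsetP Ml y yM; rewrite in_dblarc => yl.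
rewrite (adj_pos a) => /and4P[x2 y2 _ xy]; rewrite !in_cycarc x2 y2 /=.
by move: xy ym; move: (pos a x) (pos a y) yl => p q; lia.
Qed.

Lemma arc_card a l : (l <= n.+1)%N -> #|cycarc a l| = l.
Proof.
move=> ln.
have -> : cycarc a l = [set vx a k | k : 'I_l].
  apply/setP => u; rewrite in_cycarc; apply/andP/imsetP => [[u2 ul]|[k _ ->]].
    by exists (Ordinal ul); rewrite // vx_pos.
  by rewrite pos_vx //; have := ltn_ord k; lia.
rewrite card_imset ?card_ord // => i j /(congr1 (pos a)).
have := ltn_ord i; have := ltn_ord j => ? ?.
by rewrite !pos_vx; [move=> ?; apply: val_inj|lia|lia].
Qed.

(** The arc contributes both signs of its own positions, but only the positive copies of its outer
    neighbours, at positions [m] and [n]; these coincide when [m = n]. *)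
Lemma in_nbhd_arc a m u : (0 < m <= n)%N ->
  (u \in nbhd (cycarc a m)) =
  (pos a u < m)%N || u.2 && ((pos a u == m) || (pos a u == n)).
Proof.
case/andP=> m_gt0 mn; apply/nbhdP/idP => [[v]|].
  rewrite in_cycarc => /andP[v2 vm] /or3P[/eqP->|vu|/eqP vu]; first by rewrite vm.
    move: vu vm; rewrite (adj_pos a) => /and4P[_ -> _].
    by have := ltn_pos a u; move: (pos a u) (pos a v) => p q; lia.
  by move: vm; rewrite vu => ->.
case/orP => [um|/andP[u2 /orP[/eqP um|/eqP un]]].
- case: u um => i [] um; first by exists (i, true); rewrite ?in_cycarc // /clash eqxx.
  by exists (i, true); [rewrite in_cycarc | rewrite /clash /antipode eqxx orbT orbT].
- exists (vx a m.-1); first by rewrite in_cycarc pos_vx /=; lia.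
  by rewrite /clash (adj_pos a) u2 pos_vx ?um /= ?orbT; lia.
exists (vx a 0); first by rewrite in_cycarc pos_vx.
by rewrite /clash (adj_pos a) u2 pos_vx ?un //=; lia.
Qed.

Lemma sum_tubes_from (R : nmodType) (F : {set pmn n.+1} -> R) a l X : (l <= n)%N ->
  cycarc a l \subset X -> X \subset dblarc a l ->
  \sum_(M : {set pmn n.+1} | [&& tube M, M \subset X & vx a 0 \in M]) F M =
  \sum_(m < l) F (cycarc a m.+1).
Proof.
move=> ln lX Xl.
rewrite (eq_bigl (mem [set cycarc a m.+1 | m : 'I_l])); last first.
  move=> M; apply/and3P/imsetP => [[tM MX aM]|[m _ ->]].
    have [m ml ->] := tube_arcP ln tM (subset_trans MX Xl) aM.
    by exists (Ordinal ml).
  have ml := ltn_ord m; split; last by rewrite in_cycarc pos_vx.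
    by apply: tube_arc; lia.
  apply: subset_trans lX; apply/subsetP => u; rewrite !in_cycarc => /andP[-> um] /=.
  exact: leq_trans um ml.
rewrite big_imset /=; first by apply: eq_bigl.
move=> i j _ _ /(congr1 (fun M : {set pmn n.+1} => #|M|)).
have := ltn_ord i; have := ltn_ord j => ? ?.
by rewrite !arc_card; [move=> [?]; apply: val_inj|lia|lia].
Qed.

End Arcs.

(** * Recursions for the weights of arcs, doubled arcs and the cycle *)

Section Weights.
Variable n : nat.
Implicit Types (a i j : 'I_n.+1) (u v : pmn n.+1) (M X : {set pmn n.+1}).

Lemma tube_negative i M : tube M -> (i, false) \in M -> M = [set (i, false)].
Proof.
move=> tM iM; apply/eqP; rewrite eqEsubset sub1set iM andbT.
apply/subsetP; apply: (@tube_ind _ (fun u => u \in [set (i, false)]) M (i, false)) => //.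
  by rewrite inE.
by move=> x y _ _ xy; rewrite inE => /eqP xE; move: xy; rewrite xE.
Qed.

Lemma tube_set1 i : tube [set (i, false) : pmn n.+1].
Proof.
apply/and3P; split; first by apply/set0Pn; exists (i, false); rewrite inE.
  by apply/forall_inP => u /set1P->; apply/forall_inP => v /set1P->.
by apply/forall_inP => u /set1P->; rewrite inE xpair_eqE andbF.
Qed.

Lemma wt0_set1 i : wt0 [set (i, false) : pmn n.+1] = 1.
Proof.
rewrite /wt0 (big_pred1 set0) ?cards0 // => T; apply/andP/eqP =>
  [[/tubings_inP[tT T1 _] nT]|->].
  apply/setP => t; rewrite [RHS]inE; apply: contraNF nT => tinT.
  have := T1 t tinT; rewrite subset1 (negPf (tube_neq0 (tT t tinT))) orbF.
  by move=> /eqP <-.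
split; last by rewrite inE.
by apply/tubings_inP; split=> [t|t|s t]; rewrite inE.
Qed.

(** The only tube through the isolated vertex [(i, false)] is its singleton, whose neighbourhood
    adds only the antipode. *)
Lemma wt_neg i X : (i, false) \in X ->
  wt X = wt (X :\ (i, false)) + 'X * wt (X :\ (i, false) :\ (i, true)).
Proof.
move=> iX; rewrite (wt_rec iX); congr (_ + _).
rewrite (big_pred1 [set (i, false)]) => [|M].
  rewrite wt0_set1 mulr1; congr (_ * wt _); apply/setP => u; rewrite !in_setD1 in_setD andbA.
  rewrite -negb_or; congr (~~ _ && _); apply/nbhdP/orP => [[v /set1P->]|]; last first.
    by case=> /eqP->; exists (i, false); rewrite ?inE // /clash /antipode /= ?eqxx ?orbT.
  by case/or3P => [/eqP->|//|/eqP->]; [right | left].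
rewrite /=; apply/and3P/eqP => [[tM _ /(tube_negative tM)]//|->].
by split; rewrite ?tube_set1 ?sub1set ?inE.
Qed.

Lemma wt_neg_only i X : (i, false) \in X -> (i, true) \notin X ->
  wt X = (1 + 'X) * wt (X :\ (i, false)).
Proof.
move=> iX niX; rewrite (wt_neg iX) mulrDl mul1r; congr (_ + 'X * wt _).
by apply/setDidPl; rewrite disjoint_sym disjoints1 !inE (negPf niX) andbF.
Qed.

(** Position [m.+1] is lost as a neighbour of the tube. For [m = l] the truncated subtraction gives
    the empty arc. *)
Lemma arcD_nbhd a l m : (l.+1 <= n)%N -> (m <= l)%N ->
  cycarc a l.+1 :\: nbhd (cycarc a m.+1) = cycarc (a + inZp m.+2) (l - m.+1).
Proof.
move=> ln ml; apply/setP => u; rewrite in_setD in_nbhd_arc; last by lia.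
rewrite in_cycarc.
have := ltn_pos a u => un.
have [ml'|lm] := ltnP m l; first by rewrite in_cycarc_shift; [case: u.2 => //=; lia|lia|lia].
have -> : (l - m.+1 = 0)%N by lia.
by rewrite in_cycarc ltn0 andbF; case: u.2 => //=; lia.
Qed.

Lemma cycarc0 a : cycarc a 0 = set0.
Proof. by apply/setP => u; rewrite !inE ltn0 andbF. Qed.

Lemma dblarc0 a : dblarc a 0 = set0.
Proof. by apply/setP => u; rewrite !inE ltn0. Qed.

Lemma pos_vertex a k b : (k <= n)%N -> pos a (a + inZp k, b) = k.
Proof. exact: pos_vx. Qed.

Lemma eq_vertex a k b u : (k <= n)%N ->
  (u == (a + inZp k, b)) = (u.2 == b) && (pos a u == k).
Proof.
move=> kn; apply/eqP/andP => [->|[/eqP ub /eqP uk]].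
  by rewrite pos_vertex.
by apply: (@pos_inj n a u (a + inZp k, b) ub); rewrite uk pos_vertex.
Qed.

Lemma arcD1 a l : (l <= n)%N -> cycarc a l.+1 :\ vx a 0 = cycarc (a + inZp 1) l.
Proof.
move=> ln; apply/setP => u; rewrite in_setD1 eq_vertex //.
have un := ltn_pos a u; case: (posnP l) => [->|l_gt0].
  by rewrite cycarc0 in_set0 in_cycarc; case: u.2 => //=; lia.
by rewrite in_cycarc_shift ?in_cycarc; [case: u.2 => //=; lia|lia|lia].
Qed.

Lemma dblarcD1 a l : (l <= n)%N ->
  dblarc a l.+1 :\ (a + inZp 0, false) :\ vx a 0 = dblarc (a + inZp 1) l.
Proof.
move=> ln; apply/setP => u; rewrite !in_setD1 !eq_vertex //.
have un := ltn_pos a u; case: (posnP l) => [->|l_gt0].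
  by rewrite dblarc0 in_set0 in_dblarc; case: u.2 => //=; lia.
by rewrite in_dblarc_shift ?in_dblarc; [case: u.2 => //=; lia|lia|lia].
Qed.

(** The top tube equal to the whole arc contributes ['X * wt0] of that arc, which cancels against
    the same term in [(1 + 'X) * wt0]. *)
Lemma wt_arcS a l : (l.+1 <= n)%N ->
  wt0 (cycarc a l.+1) = wt (cycarc (a + inZp 1) l) +
    \sum_(m < l) 'X * wt0 (cycarc a m.+1) * wt (cycarc (a + inZp m.+2) (l - m.+1)).
Proof.
move=> ln; have tX : tube (cycarc a l.+1) by apply: tube_arc; lia.
have aX : vx a 0 \in cycarc a l.+1 by rewrite in_cycarc pos_vx.
have := wt_rec aX; rewrite (sum_tubes_from _ ln (subxx _)); last first.
  by apply/subsetP => u; rewrite !inE => /andP[].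
rewrite wt_tube // arcD1 1?ltnW //.
under eq_bigr => m _ do rewrite arcD_nbhd -1?ltnS //.
rewrite big_ord_recr /= (_ : l - l.+1 = 0)%N; last by lia.
rewrite cycarc0 wt_set0 mulr1 addrA mulrDl mul1r.
exact: addIr.
Qed.

(** The antipode of [vx a 0] is split off first, then [vx a 0] itself; each time the doubled arc
    shifted by 1 remains, whence the first [1 + 'X]. Next to a shorter tube, only the negative
    vertex survives at position [m.+1], which gives the factor [1 + 'X] in the sum. *)
Lemma wt_dblarcS a l : (l.+1 <= n)%N ->
  wt (dblarc a l.+1) = (1 + 'X) * wt (dblarc (a + inZp 1) l) +
    \sum_(m < l) 'X * wt0 (cycarc a m.+1) *
                 ((1 + 'X) * wt (dblarc (a + inZp m.+2) (l - m.+1)))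
    + 'X * wt0 (cycarc a l.+1).
Proof.
move=> ln; rewrite (@wt_neg (a + inZp 0)); last by rewrite in_dblarc pos_vertex.
rewrite -/(vx a 0) dblarcD1 1?ltnW //.
set Y := _ :\ (_, false).
have inY u : (u \in Y) = (u.2 || (pos a u != 0%N)) && (pos a u < l.+1)%N.
  by rewrite in_setD1 eq_vertex // in_dblarc; case: u.2.
have aY : vx a 0 \in Y by rewrite inY pos_vx.
rewrite (wt_rec aY) (@sum_tubes_from _ _ _ a l.+1) //; last 2 first.
- by apply/subsetP => u; rewrite inY in_cycarc => /andP[-> ->].
- by apply/subsetP => u; rewrite inY in_dblarc => /andP[].
rewrite dblarcD1 1?ltnW // big_ord_recr /=.
have -> : Y :\: nbhd (cycarc a l.+1) = set0.
  apply/setP => u; rewrite in_setD in_nbhd_arc ?inY ?in_set0; last by lia.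
  by have := ltn_pos a u; case: u.2 => //=; lia.
rewrite wt_set0 mulr1 (eq_bigr (fun m : 'I_l => 'X * wt0 (cycarc a m.+1) *
  ((1 + 'X) * wt (dblarc (a + inZp m.+2) (l - m.+1))))); first by ring.
move=> m _; congr (_ * _).
have ml := ltn_ord m.
have nb u : (u \in Y :\: nbhd (cycarc a m.+1)) =
  (m.+1 + u.2 <= pos a u < l.+1)%N.
  rewrite in_setD in_nbhd_arc ?inY; last by lia.
  by have := ltn_pos a u; case: u.2 => //=; lia.
rewrite (@wt_neg_only (a + inZp m.+1)) ?nb ?pos_vertex /=; [|lia|lia|lia|lia].
congr (_ * wt _); apply/setP => u; rewrite in_setD1 eq_vertex ?nb; last by lia.
have := ltn_pos a u; have [ml'|lm] := ltnP m.+1 l.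
  by rewrite in_dblarc_shift; [case: u.2 => //=; lia|lia|lia].
have -> : (l - m.+1 = 0)%N by lia.
by rewrite in_dblarc; case: u.2 => //=; lia.
Qed.

Lemma inZpD k l : inZp (k + l) = inZp k + inZp l :> 'I_n.+1.
Proof. by apply: val_inj; rewrite /= modnDm. Qed.

Lemma inZp0 : inZp 0 = 0 :> 'I_n.+1.
Proof. by apply: val_inj; rewrite /= mod0n. Qed.

Lemma vx0 a : vx a 0 = (a, true).
Proof. by rewrite /vx inZp0 addr0. Qed.

(** A tube through a fixed positive vertex is the whole cycle or an arc of [m <= n] vertices, and
    the vertex can sit at any of the [m] positions of the arc, whence the multiplicity. *)
Lemma sum_tubes_cycle (R : nmodType) (F : {set pmn n.+1} -> R) (G : nat -> R) X :
  (forall u, u.2 -> u \in X) ->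
  (forall a m, (0 < m <= n)%N -> vx 0 0 \in cycarc a m -> F (cycarc a m) = G m) ->
  \sum_(M : {set pmn n.+1} | [&& tube M, M \subset X & vx 0 0 \in M]) F M =
  F (cycarc 0 n.+1) + \sum_(m < n.+1) G m *+ m.
Proof.
move=> posX FG.
have fullE u : (u \in cycarc 0 n.+1) = u.2.
  by rewrite in_cycarc [(_ < _)%N]ltnS ltn_pos andbT.
have subX a l : cycarc a l \subset X.
  by apply/subsetP => u; rewrite in_cycarc => /andP[/posX].
(* [st k] lies [k] steps before the fixed vertex. Going backwards from that vertex, the first one
   missing from a tube shows where the arc begins. *)
pose st k : 'I_n.+1 := - inZp k.
have st_shift (k j : nat) : (j <= k)%N -> vx (st k) (k - j) = (st j, true).
  move=> jk; rewrite /vx /st; congr (_, _); apply: (addrI (inZp k)).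
  rewrite addrA subrr add0r; apply: (addIr (inZp j)); rewrite subrK.
    by rewrite -inZpD subnK.
have st_pred k : vx (st k) n = (st k.+1, true).
  rewrite /vx /st; congr (_, _); apply: (addrI (inZp k)).
  rewrite addrA subrr add0r; apply: (addIr (inZp k.+1)); rewrite subrK -inZpD.
  by apply: val_inj; rewrite /= addnS -addSn modnDl.
have vx_start k : vx 0 0 = vx (st k) k :> pmn n.+1.
  have := st_shift k 0%N (leq0n k); rewrite subn0 => ->.
  by rewrite vx0 /st inZp0 oppr0.
have pos_start k : (k <= n)%N -> pos (st k) (vx 0 0) = k.
  by move=> kn; rewrite (vx_start k) pos_vx.
rewrite (bigD1 (cycarc 0 n.+1)) /=; last by rewrite tube_arc ?subX ?fullE /=; lia.
congr (_ + _).
(* A pair [(m, k)] encodes the arc of [m] vertices that starts at [st k]. *)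
pose D := [set p : 'I_n.+1 * 'I_n.+1 | (p.2 < p.1)%N].
rewrite (eq_bigl (mem [set cycarc (st p.2) p.1 | p : 'I_n.+1 * 'I_n.+1 in D])); last first.
  move=> M; apply/andP/imsetP => [[/and3P[tM _ oM] MT]|[[m k]]]; last first.
    rewrite inE /= => km ->; have mn := ltn_ord m.
    have kn := ltn_ord k; rewrite tube_arc ?subX ?in_cycarc ?pos_start ?km /=; [|lia|lia].
    split=> //; apply/eqP => /(congr1 (fun M : {set pmn n.+1} => #|M|)).
    by rewrite !arc_card; lia.
  have Mpos := tube_positive tM oM isT.
  have exk : exists k, (k <= n)%N && ((st k, true) \notin M).
    case: (pickP [pred i | (i, true) \notin M]) => [i /= iM|allM].
      by exists (- i : 'I_n.+1); rewrite /st valZpK opprK iM -ltnS ltn_ord.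
    case/eqP: MT; apply/setP => u; rewrite fullE.
    apply/idP/idP => [/Mpos//|]; case: u => i [] // _.
    by have /negbFE := allM i.
  case: (ex_minnP exk) => -[|k] /andP[kn kM] k_min.
    by move: kM; rewrite -vx0 -vx_start oM.
  have stM : vx (st k) 0 \in M.
    rewrite vx0; apply: contraT => kM'.
    by have := k_min k; rewrite kM' ltnn (ltnW kn) => /(_ isT).
  have Mdbl : M \subset dblarc (st k) n.
    apply/subsetP => u uM; rewrite in_dblarc ltn_neqAle ltn_pos andbT.
    apply: contraNneq kM => un; rewrite -st_pred.
    by have := vx_pos (st k) (Mpos u uM); rewrite un => ->.
  have [m mn ME] := tube_arcP (leqnn n) tM Mdbl stM.
  have km : (k < m.+1)%N.
    by move: oM; rewrite ME in_cycarc (pos_start k (ltnW kn)) => /andP[].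
  have kn' : (k < n.+1)%N by lia.
  exists (Ordinal (mn : (m.+1 < n.+1)%N), Ordinal kn') => //.
  by rewrite inE.
rewrite big_imset /=; last first.
  (* The vertex just before [st k] is at position [n] from it, hence outside the first arc, but it
     lies in the arc that starts further back at [st k']. *)
  have neq m k k' : (k < k')%N -> (k' < m)%N -> (m <= n)%N ->
      cycarc (st k) m <> cycarc (st k') m.
    move=> kk' k'm mn /setP/(_ (st k.+1, true)).
    rewrite -{1}st_pred -(st_shift k') // !in_cycarc !pos_vx //=; lia.
  move=> [m k] [m' k']; rewrite !inE /= => km km' eqM.
  have mn := ltn_ord m; have m'n := ltn_ord m'.
  have mm' : m = m'.
    apply: val_inj; move/(congr1 (fun M : {set pmn n.+1} => #|M|)): eqM.
    by rewrite !arc_card //; lia.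
  move: eqM; rewrite -mm' in km' *; case: (ltngtP k k') => [lt|lt|/val_inj-> //] eqM.
    by case: (neq m k k' lt km').
  by case: (neq m k' k lt km).
rewrite (eq_bigr (fun p : 'I_n.+1 * 'I_n.+1 => G p.1)); last first.
  move=> [m k]; rewrite inE /= => km; have mn := ltn_ord m; have kn := ltn_ord k.
  apply: FG; first by lia.
  by rewrite in_cycarc pos_start ?km //; lia.
rewrite (eq_bigl (fun p : 'I_n.+1 * 'I_n.+1 => true && (p.2 < p.1)%N)); last first.
  by move=> p; rewrite inE.
rewrite -(pair_big_dep predT (fun i j : 'I_n.+1 => (j < i)%N) (fun i _ => G i)) /=.
apply: eq_bigr => m _; rewrite sumr_const; congr (_ *+ _).
by rewrite -sum1_card (big_ord_narrow (ltnW (ltn_ord m))) sum1_card card_ord.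
Qed.
End Weights.

(* An arc of [l] vertices is taken in the smallest cycle containing it properly, on
   [l.+1] vertices; [wt0_arc] shows that the choice of cycle does not matter. *)
Definition arc_wt0 l : {poly rat} := wt0 (@cycarc l 0 l).
(** The empty arc is not a tube, so the factor [1 + 'X] of [wt_tube] does not apply to it. *)
Definition arc_wt l : {poly rat} := if l is 0 then 1 else (1 + 'X) * arc_wt0 l.
(** The doubled arc, too, is placed in the smallest cycle that contains it properly. *)
Definition dblarc_wt l : {poly rat} := wt (@dblarc l 0 l).
(** The weight of what precedes the next uncovered vertex: nothing, or one maximal tube of [l]
    vertices. With weight 1 for the empty gap, an uncovered first vertex is the term [m = 0] of the
    convolutions below. *)
Definition gap_wt l : {poly rat} := if l is 0 then 1 else 'X * arc_wt0 l.

Lemma wt_arc_tube n (a : 'I_n.+1) l : (0 < l <= n.+1)%N ->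
  wt (cycarc a l) = (1 + 'X) * wt0 (cycarc a l).
Proof. by move=> ln; apply/wt_tube/tube_arc. Qed.

Lemma wt0_arc n (a : 'I_n.+1) l : (0 < l <= n)%N -> wt0 (cycarc a l) = arc_wt0 l.
Proof.
suff indep : forall l n n' (a : 'I_n.+1) (a' : 'I_n'.+1), (0 < l)%N ->
    (l <= n)%N -> (l <= n')%N ->
    wt0 (cycarc a l) = wt0 (cycarc a' l) by case/andP=> ? ?; apply: indep.
elim/ltn_ind => -[//|{}l] IHl {}n n' {}a a' _ ln ln'.
have wtE k (b : 'I_n.+1) (b' : 'I_n'.+1) : (k <= l)%N -> wt (cycarc b k) = wt (cycarc b' k).
  case: k => [|k] kl; first by rewrite !cycarc0 !wt_set0.
  by rewrite !wt_arc_tube ?(IHl k.+1 _ n n' b b') //; lia.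
rewrite !wt_arcS // (wtE l _ (a' + inZp 1)) //; congr (_ + _).
apply: eq_bigr => m _; have ml := ltn_ord m.
by rewrite (wtE _ _ (a' + inZp m.+2)) ?(IHl m.+1 _ n n' a a') //; lia.
Qed.

Lemma wt_arc n (a : 'I_n.+1) l : (l <= n)%N -> wt (cycarc a l) = arc_wt l.
Proof.
case: l => [|l] ln; first by rewrite cycarc0 wt_set0.
by rewrite wt_arc_tube ?wt0_arc //; lia.
Qed.

Lemma wt_dblarc n (a : 'I_n.+1) l : (l <= n)%N -> wt (dblarc a l) = dblarc_wt l.
Proof.
suff indep : forall l n n' (a : 'I_n.+1) (a' : 'I_n'.+1), (l <= n)%N -> (l <= n')%N ->
    wt (dblarc a l) = wt (dblarc a' l) by move=> ?; apply: indep.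
elim/ltn_ind => -[|{}l] IHl {}n n' {}a a' ln ln'; first by rewrite !dblarc0 !wt_set0.
rewrite !wt_dblarcS // (IHl l (leqnn _) n n' _ (a' + inZp 1) (ltnW ln) (ltnW ln')).
rewrite !wt0_arc ?ln ?ln' //; congr (_ + _ + _).
apply: eq_bigr => m _; have ml := ltn_ord m.
rewrite !wt0_arc ?(IHl _ _ n n' _ (a' + inZp m.+2)) //; lia.
Qed.

Lemma arc_wt0_rec l : arc_wt0 l.+1 = \sum_(m < l.+1) gap_wt m * arc_wt (l - m).
Proof.
rewrite /arc_wt0 wt_arcS // big_ord_recl mul1r subn0 wt_arc //; congr (_ + _).
by apply: eq_bigr => m _; have ml := ltn_ord m; rewrite wt0_arc ?wt_arc //; lia.
Qed.

Lemma dblarc_wt0 : dblarc_wt 0 = 1.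
Proof. by rewrite /dblarc_wt dblarc0 wt_set0. Qed.

Lemma dblarc_wt_rec l :
  dblarc_wt l.+1 = (1 + 'X) * (\sum_(m < l.+1) gap_wt m * dblarc_wt (l - m)) + gap_wt l.+1.
Proof.
rewrite {1}/dblarc_wt wt_dblarcS // big_ord_recl mul1r subn0 wt_dblarc // mulrDr.
rewrite wt0_arc ?leqnn //; congr (_ + _ + _); rewrite mulr_sumr.
apply: eq_bigr => m _; have ml := ltn_ord m.
by rewrite wt0_arc ?wt_dblarc 1?mulrCA //; lia.
Qed.

(** The index [n] belongs to the cycle on [n.+1] vertices. The summands treat a fixed vertex that is
    uncovered, one whose top tube misses at least two vertices, and one whose top tube misses
    exactly one. *)
Definition cycle_wt0 n : {poly rat} :=
  arc_wt n + \sum_(m < n) (gap_wt m * arc_wt (n - m.+1)) *+ m + gap_wt n *+ n.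

Lemma wt0_cycle n : wt0 (@cycarc n 0 n.+1) = cycle_wt0 n.
Proof.
have aX : vx 0 0 \in @cycarc n 0 n.+1 by rewrite in_cycarc pos_vx.
have := wt_rec aX.
rewrite (sum_tubes_cycle
  (G := fun m => if m == n then gap_wt n else gap_wt m * arc_wt (n - m.+1))).
- rewrite wt_arc_tube ?leqnn // arcD1 // wt_arc // big_ord_recr /= eqxx.
  rewrite [_ :\: _](_ : _ = set0) ?wt_set0 ?mulr1; last first.
    by apply/setP => u; rewrite in_setD in_set0; apply/negbTE/nandP;
      case: (boolP (u \in cycarc 0 n.+1)) => [/(subsetP (sub_nbhd _))->|]; [left|right].
  rewrite (eq_bigr (fun m : 'I_n => (gap_wt m * arc_wt (n - m.+1)) *+ m)); last first.
    by move=> m _; rewrite ltn_eqF.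
  rewrite mulrDl mul1r => wt_eq; apply: (addIr ('X * wt0 (cycarc 0 n.+1))).
  by apply: etrans wt_eq _; rewrite /cycle_wt0; ring.
- by move=> u u2; rewrite in_cycarc u2 [(_ < _)%N]ltnS ltn_pos.
move=> a m mn am; rewrite wt0_arc // -[RHS]/(_).
have -> : cycarc 0 n.+1 :\: nbhd (cycarc a m) = cycarc (a + inZp m.+1) (n - m.+1).
  apply/setP => u; rewrite in_setD in_nbhd_arc // in_cycarc [(_ < n.+1)%N]ltnS ltn_pos andbT.
  have un := ltn_pos a u; have [m_n|nm] := ltnP m n.
    by rewrite in_cycarc_shift; [case: u.2 => //=; lia|lia|lia].
  have -> : (n - m.+1 = 0)%N by lia.
  by rewrite in_cycarc; case: u.2 => //=; lia.
rewrite wt_arc; last by lia.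
case: eqP => [m_n|_]; last by case: m mn {am}.
have -> : (n - m.+1 = 0)%N by lia.
by rewrite mulr1 m_n; case: n mn m_n {a am aX} => //; lia.
Qed.

(** The antipode of a fixed vertex is split off first, then the vertex itself. Beside a top tube of
    [m < n] vertices the negatives of its two outer neighbours remain as isolated vertices, whence
    [(1 + 'X) ^+ 2]; for [m = n] the two neighbours are one vertex. Beside the whole cycle nothing
    remains. *)
Lemma wt_halohedron n :
  wt [set: pmn n.+1] = (1 + 'X) * dblarc_wt n
    + (1 + 'X) ^+ 2 * (\sum_(m < n) (gap_wt m * dblarc_wt (n - m.+1)) *+ m)
    + (1 + 'X) * (gap_wt n *+ n) + 'X * cycle_wt0 n.
Proof.
have -> : [set: pmn n.+1] = dblarc 0 n.+1.
  by apply/setP => u; rewrite in_dblarc in_setT [(_ < _)%N]ltnS ltn_pos.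
rewrite (@wt_neg _ (0 + inZp 0)); last by rewrite in_dblarc pos_vertex.
rewrite -/(vx 0 0) dblarcD1 //.
set Y := _ :\ (_, false).
have inY u : (u \in Y) = (u.2 || (pos 0 u != 0%N)).
  by rewrite in_setD1 eq_vertex // in_dblarc [(_ < n.+1)%N]ltnS ltn_pos andbT; case: u.2.
have aY : vx 0 0 \in Y by rewrite inY pos_vx.
rewrite (wt_rec aY) dblarcD1 //.
rewrite (sum_tubes_cycle (G := fun m => if m == n then (1 + 'X) * gap_wt n
   else (1 + 'X) ^+ 2 * (gap_wt m * dblarc_wt (n - m.+1)))).
- rewrite [_ :\: _](_ : _ = set0) ?wt_set0 ?mulr1; last first.
    apply/setP => u; rewrite in_setD in_set0; apply/negbTE/nandP; left; rewrite negbK.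
    apply/nbhdP; exists (u.1, true); first by rewrite in_cycarc [(_ < _)%N]ltnS ltn_pos.
    by case: u => i []; rewrite /clash /antipode /= eqxx ?orbT.
  rewrite wt_dblarc // wt0_cycle big_ord_recr /= eqxx.
  rewrite (eq_bigr (fun m : 'I_n =>
    (1 + 'X) ^+ 2 * ((gap_wt m * dblarc_wt (n - m.+1)) *+ m))); last first.
    by move=> m _; rewrite ltn_eqF // mulrnAr.
  by rewrite -mulr_sumr; ring.
- by move=> u u2; rewrite inY u2.
move=> a m mn am; rewrite wt0_arc //.
set Z := Y :\: _.
have inZ u : (u \in Z) = (m + u.2 <= pos a u)%N && ~~ (u.2 && (pos a u == n)).
  rewrite in_setD in_nbhd_arc // inY; have un := ltn_pos a u.
  (* Only the antipode of [vx 0 0] is missing from [Y], and the arc removes it anyway because it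
     contains [vx 0 0]. *)
  have : u.2 || (pos 0 u != 0%N) || (pos a u < m)%N.
    case u2: (u.2) => //=; case: eqP => //= u0.
    have u0E : (u.1, true) = vx 0 0 by apply: (@pos_inj _ 0) => //; rewrite pos_vx.
    have -> : pos a u = pos a (vx 0 0) by rewrite -u0E.
    by move: am; rewrite in_cycarc.
  by case: u.2 => /=; lia.
have gapE : 'X * arc_wt0 m = gap_wt m by case: m mn {am Z inZ}.
rewrite gapE (@wt_neg_only _ (a + inZp n)) ?inZ ?pos_vertex //=; [|lia|lia].
case: eqP => [m_n|m_n].
  rewrite m_n; suff -> : Z :\ (a + inZp n, false) = set0 by rewrite wt_set0; ring.
  apply/setP => u; rewrite in_setD1 eq_vertex // inZ in_set0.
  by have := ltn_pos a u; case: u.2 => //=; lia.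
have ltmn : (m < n)%N by lia.
rewrite (@wt_neg_only _ (a + inZp m)) ?in_setD1 ?inZ ?eq_vertex ?pos_vertex //=; [|lia..].
suff -> : Z :\ (a + inZp n, false) :\ (a + inZp m, false) = dblarc (a + inZp m.+1) (n - m.+1).
  by rewrite wt_dblarc; [ring|lia].
apply/setP => u; rewrite !in_setD1 !eq_vertex // ?inZ; last by lia.
have un := ltn_pos a u; rewrite in_dblarc_shift; [case: u.2 => //=; lia|lia|lia].
Qed.

(* [all_classical] shadows several [finset] lemmas used above. *)
From mathcomp Require Import finmap.
From mathcomp Require Import all_classical reals.

(** * Generating functions *)

Section Fps.
Variable R : comNzRingType.
Implicit Types f g h : fps R.

Lemma coefpsD f g n : coefps (f + g) n = coefps f n + coefps g n. Proof. by []. Qed.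
Lemma coefpsN f n : coefps (- f) n = - coefps f n. Proof. by []. Qed.
Lemma coefpsM f g n : coefps (f * g) n = \sum_(i < n.+1) coefps f i * coefps g (n - i).
Proof. by []. Qed.
Lemma coefps0 n : coefps (0 : fps R) n = 0. Proof. exact: if_same. Qed.
Lemma coefps1 n : coefps (1 : fps R) n = (n == 0%N)%:R. Proof. by case: n. Qed.
Lemma coefpsMn f k n : coefps (f *+ k) n = coefps f n *+ k.
Proof. by elim: k => [|k IHk]; rewrite ?coefps0 // !mulrS coefpsD IHk. Qed.

Lemma coefpsCM c f n : coefps (fpsC c * f) n = c * coefps f n.
Proof.
by rewrite coefpsM big_ord_recl /= subn0 big1 ?addr0 // => i _; rewrite mul0r.
Qed.

Lemma coefpsXM f n : coefps (fpsX R * f) n = if n is m.+1 then coefps f m else 0.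
Proof.
rewrite coefpsM; case: n => [|n]; first by rewrite big_ord1 mul0r.
rewrite 2!big_ord_recl /= mul0r add0r mul1r subSS subn0 big1 ?addr0 // => i _.
by rewrite mul0r.
Qed.

(** The operator y d/dy. It turns the multiplicities [m] in the sums over the cycle into a
    derivative of the series of [gap_wt]. *)
Definition euler f : fps R := FPS (fun n => coefps f n *+ n).

Lemma eulerD f g : euler (f + g) = euler f + euler g.
Proof. by apply: fpsP => n; rewrite /= mulrnDl. Qed.

Lemma eulerN f : euler (- f) = - euler f.
Proof. by apply: fpsP => n; rewrite /= mulNrn. Qed.

Lemma euler1 : euler 1 = 0.
Proof. by apply: fpsP => -[|n] /=; rewrite ?mulr0n ?mul0rn. Qed.

Lemma eulerX : euler (fpsX R) = fpsX R.
Proof. by apply: fpsP => -[|[|n]] /=; rewrite ?mulr0n ?mulr1n ?mul0rn. Qed.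

Lemma eulerCM c f : euler (fpsC c * f) = fpsC c * euler f.
Proof.
apply: fpsP => n; rewrite coefpsCM -[LHS]/(coefps (fpsC c * f) n *+ n).
by rewrite coefpsCM mulrnAr.
Qed.

Lemma eulerM f g : euler (f * g) = euler f * g + f * euler g.
Proof.
apply: fpsP => n; rewrite coefpsD !coefpsM -big_split [LHS]/= -sumrMnl.
apply: eq_bigr => i _; rewrite /= mulrnAl mulrnAr -mulrnDr subnKC //.
by rewrite -ltnS.
Qed.

(** With [h = 1 - f] the inverse is the geometric series in [h]; each coefficient comes from a
    finite partial sum, since [h ^+ k] vanishes below index [k]. *)
Lemma fps_unit_1 f : coefps f 0 = 1 -> f \is a GRing.unit.
Proof.
move=> f0.
have [h -> h0] : exists2 h, f = 1 - h & coefps h 0 = 0.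
  by exists (1 - f); rewrite ?subKr // coefpsD coefpsN f0 subrr.
have hX k n : (n < k)%N -> coefps (h ^+ k) n = 0.
  elim: k n => // k IHk n nk; rewrite exprS coefpsM big1 // => -[[|i] ilt] _ /=.
    by rewrite h0 mul0r.
  by rewrite IHk ?mulr0 //; lia.
pose g : fps R := FPS (fun n => coefps (\sum_(i < n.+1) h ^+ i) n).
have gE N n : (n < N)%N -> coefps g n = coefps (\sum_(i < N) h ^+ i) n.
  elim: N => // N IHN; rewrite ltnS leq_eqVlt => /orP[/eqP->//|nN].
  by rewrite big_ord_recr coefpsD (hX _ _ nN) addr0 IHN.
have gf : g * (1 - h) = 1.
  apply: fpsP => n.
  transitivity (coefps ((\sum_(i < n.+1) h ^+ i) * (1 - h)) n).
    rewrite !coefpsM; apply: eq_bigr => i _; congr (_ * _).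
    by apply: gE; exact: ltn_ord.
  rewrite mulrC -[1 - h]opprB mulNr -subrX1 opprB coefpsD coefpsN hX ?subr0 //.
by apply/unitrP; exists g; rewrite gf mulrC gf.
Qed.

End Fps.

(** The elimination, valid in any commutative ring. [Q], [A], [B], [C] stand for the series of
    [gap_wt], [arc_wt], [dblarc_wt], [cycle_wt0], [P] for that of [arc_wt0] without constant term,
    and [D] for [euler Q]. The last hypothesis, which passes from an equation for [u] to one for its
    derivative [t], is the only ingredient that is not algebraic. *)
Lemma halohedron_series_identity (R : comNzRingType) (y z Q A P B D C S u r t : R) :
  Q = 1 + z * P -> A = 1 + (1 + z) * P -> P = y * Q * A ->
  B = Q + (1 + z) * (y * Q * B) -> C = A + y * D * A + D ->
  S = 1 + y * ((1 + z) * B + (1 + z) ^+ 2 * (y * D * B) + (1 + z) * D + z * C) ->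
  u = y * Q -> r = 1 + y - 2 * (1 + z) * u -> t = y * (Q + D) ->
  (u * (1 - (1 + z) * u) = y * (1 - u) -> t * r = y * (1 - u)) ->
  r ^+ 2 = 1 - 2 * (1 + 2 * z) * y + y ^+ 2 /\
  2 * r * S = r + 1 + (1 + 2 * z) * y.
Proof.
move=> EQ EA EP EB EC ES Eu Er Et tr.
pose e := 1 - (1 + z) * u.
have {}EP : P = u * A by rewrite EP Eu.
have Ae : A * e = 1.
  by transitivity (A - (1 + z) * P); [rewrite EP /e; ring | rewrite {1}EA; ring].
have Qe : Q * e = 1 - u.
  transitivity (e + z * u * (A * e)); first by rewrite EQ EP; ring.
  by rewrite Ae /e; ring.
have BQA : B = Q * A.
  have Be : B * e = Q.
    by transitivity (B - (1 + z) * (u * B)); [rewrite /e; ring | rewrite {1}EB Eu; ring].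
  by rewrite -Be mulrAC -mulrA Ae mulr1.
have ue : u * e = y * (1 - u) by rewrite -Qe Eu; ring.
have {}tr := tr ue.
have AQ : A * (1 - u) = Q by rewrite -Qe mulrCA Ae mulr1.
have w1 : (1 + y * A) * (1 - u) = 1.
  by transitivity (1 - u + y * (A * (1 - u))); [ring | rewrite AQ -Eu; ring].
split.
  transitivity ((1 + y) ^+ 2 - 4 * (1 + z) * (u * e + y * u)); first by rewrite Er /e; ring.
  by rewrite ue; ring.
have ES' : S = 1 + (1 + z) * (A * t) + z * ((1 + y * A) * t).
  have EA' : A = 1 + (1 + z) * (y * Q * A) by rewrite {1}EA EP Eu.
  have EA'' : A = (1 + y * A) * Q.
    by rewrite -AQ mulrCA w1 mulr1.
  rewrite ES EC BQA Et.
  transitivity (1 + y * ((1 + z) * (Q * A) + (1 + z) * D * (1 + (1 + z) * (y * Q * A)) +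
    z * (A + D * (1 + y * A)))); first by ring.
  by rewrite -EA' {3}EA''; ring.
transitivity (2 * r + 2 * (1 + z) * A * (t * r) + 2 * z * (1 + y * A) * (t * r)).
  by rewrite ES'; ring.
rewrite tr -{1}ue.
transitivity (2 * r + 2 * (1 + z) * u * (A * e) + 2 * z * y * ((1 + y * A) * (1 - u))).
  by ring.
by rewrite Ae w1 Er; ring.
Qed.

Lemma fps_unit_const (R : comUnitRingType) (f : fps R) :
  coefps f 0 \is a GRing.unit -> f \is a GRing.unit.
Proof.
move=> uf.
have cK c : c \is a GRing.unit -> fpsC c * fpsC c^-1 = 1.
  move=> uc; apply: fpsP => n; rewrite coefpsCM coefps1 /=.
  by case: n => [|n]; rewrite ?mulr0 ?divrr.
have -> : f = fpsC (coefps f 0) * (fpsC (coefps f 0)^-1 * f) by rewrite mulrA cK ?mul1r.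
rewrite unitrM; apply/andP; split.
  by apply/unitrP; exists (fpsC (coefps f 0)^-1); rewrite mulrC cK.
by apply: fps_unit_1; rewrite coefpsCM mulVr.
Qed.

(** * The series of all tubings and its functional equation *)

Local Notation pol := {poly rat}.
Local Notation y := (fpsX pol).
Local Notation z := (fpsC ('X : pol)).

Definition tubing_series : fps pol := FPS (fun n => wt [set: pmn n]).

Lemma tubing_series_eq : exists r : fps pol,
  [/\ coefps r 0 = 1, r ^+ 2 = 1 - 2 * (1 + 2 * z) * y + y ^+ 2
    & 2 * r * tubing_series = r + 1 + (1 + 2 * z) * y].
Proof.
pose Q : fps pol := FPS gap_wt; pose A : fps pol := FPS arc_wt.
pose B : fps pol := FPS dblarc_wt; pose C : fps pol := FPS cycle_wt0.
pose P : fps pol := FPS (fun n => if n == 0%N then 0 else arc_wt0 n).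
pose D := euler Q; pose u := y * Q.
have z1E : 1 + z = fpsC (1 + 'X) by apply: fpsP => -[|n] /=; rewrite ?addr0.
have EQ : Q = 1 + z * P.
  apply: fpsP => n; rewrite coefpsD coefpsCM coefps1 /=.
  by case: n => [|n] /=; rewrite ?mulr0 ?addr0 ?add0r.
have EA : A = 1 + (1 + z) * P.
  apply: fpsP => n; rewrite z1E coefpsD coefpsCM coefps1 /=.
  by case: n => [|n] /=; rewrite ?mulr0 ?addr0 ?add0r.
have EP : P = y * Q * A.
  by apply: fpsP => n; rewrite -mulrA coefpsXM; case: n => //= n; exact: arc_wt0_rec.
have EB : B = Q + (1 + z) * (y * Q * B).
  apply: fpsP => n; rewrite z1E coefpsD coefpsCM -mulrA coefpsXM.
  case: n => [|n] /=; first by rewrite mulr0 addr0 dblarc_wt0.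
  by rewrite dblarc_wt_rec addrC.
have mulyD (F : fps pol) n : coefps (y * D * F) n =
    \sum_(m < n) (gap_wt m * coefps F (n - m.+1)) *+ m.
  rewrite -mulrA coefpsXM; case: n => [|n]; first by rewrite big_ord0.
  by rewrite coefpsM; apply: eq_bigr => m _; rewrite mulrnAl.
have EC : C = A + y * D * A + D.
  by apply: fpsP => n; rewrite !coefpsD mulyD.
have ES : tubing_series =
    1 + y * ((1 + z) * B + (1 + z) ^+ 2 * (y * D * B) + (1 + z) * D + z * C).
  apply: fpsP => -[|n].
    rewrite coefpsD coefpsXM coefps1 addr0 -(wt_set0 0).
    by congr wt; apply/setP => -[[]].
  rewrite z1E expr2 -!mulrA coefpsD coefpsXM coefps1 add0r [LHS]wt_halohedron.
  by rewrite !coefpsD !coefpsCM (mulrA y D B) mulyD expr2 -!mulrA.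
have eu : euler u = y * (Q + D) by rewrite eulerM eulerX mulrDr.
exists (1 + y - 2 * (1 + z) * u).
have [] := halohedron_series_identity EQ EA EP EB EC ES (erefl u) erefl (erefl (y * (Q + D))).
  (* Applying [euler] to the equation for [u] and collecting the terms in [t] gives
     [t * r = y * (1 - u)]. *)
  rewrite z1E => /(congr1 (@euler _)).
  rewrite !(eulerM _ (1 - _)) !eulerD !eulerN euler1 eulerCM eulerX eu -z1E => e.
  move/(congr1 (fun f => f + y * (y * (Q + D)))): e.
  move: (y * (Q + D)) => t e.
  transitivity (t * (1 - (1 + z) * u) + u * (0 - (1 + z) * t) + y * t); first by ring.
  by rewrite e; ring.
move=> r2 rS; split=> //.
have -> : 1 + y - 2 * (1 + z) * u = 1 + y * (1 - 2 * (1 + z) * Q) by rewrite /u; ring.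
by rewrite coefpsD coefpsXM coefps1 addr0.
Qed.

(* Coefficientwise, [homog] below substitutes 1/x for z and x * y for y. *)
Definition rev_poly n (p : pol) : pol := \poly_(k < n.+1) p`_(n - k).

Lemma rev_polyD n : {morph rev_poly n : p q / p + q}.
Proof.
by move=> p q; apply/polyP => k; rewrite coefD !coef_poly coefD; case: ifP; rewrite ?addr0.
Qed.

Lemma rev_poly0 n : rev_poly n 0 = 0.
Proof. by apply/polyP => k; rewrite coef_poly !coef0 if_same. Qed.

Lemma rev_poly_mono n c a : (a <= n)%N -> rev_poly n (c *: 'X^a) = c *: 'X^(n - a).
Proof.
move=> an; apply/polyP => k; rewrite coef_poly !coefZ !coefXn.
case: ltnP => kn; last by rewrite (_ : k == _ = false) ?mulr0 //; lia.
by congr (_ * _%:R); lia.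
Qed.

Lemma poly_sum_mono n (p : pol) : (size p <= n)%N -> p = \sum_(a < n) p`_a *: 'X^a.
Proof.
move=> pn; rewrite -poly_def; apply/polyP => k; rewrite coef_poly.
by case: ltnP => // nk; rewrite nth_default // (leq_trans pn).
Qed.

(** Without the degree bounds [rev_poly] would drop terms. By additivity only monomials have to be
    compared. *)
Lemma rev_polyM i j (p q : pol) : (size p <= i.+1)%N -> (size q <= j.+1)%N ->
  rev_poly (i + j) (p * q) = rev_poly i p * rev_poly j q.
Proof.
move=> /poly_sum_mono-> /poly_sum_mono->.
rewrite !(big_morph _ (rev_polyD _) (rev_poly0 _)) !big_distrlr /=.
rewrite !(big_morph _ (rev_polyD _) (rev_poly0 _)); apply: eq_bigr => a _.
rewrite !(big_morph _ (rev_polyD _) (rev_poly0 _)); apply: eq_bigr => b _.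
have := ltn_ord a; have := ltn_ord b => bj ai.
rewrite -scalerAl -scalerAr scalerA -exprD !rev_poly_mono; [|lia|lia|lia].
rewrite -scalerAl -scalerAr scalerA -exprD; congr (_ *: 'X^_); lia.
Qed.

Definition homog (f : fps pol) : fps2 :=
  FPS (fun n => FPS (fun k => (rev_poly n (coefps f n))`_k)).

(** Under this bound the substitution produces no negative power of x, so [homog] loses nothing. *)
Definition degree_bounded (f : fps pol) := forall n, (size (coefps f n) <= n.+1)%N.

Lemma homogM f g : degree_bounded f -> degree_bounded g ->
  homog (f * g) = homog f * homog g.
Proof.
move=> bf bg; apply: fpsP => n; apply: fpsP => k.
rewrite [LHS]/= (big_morph _ (rev_polyD _) (rev_poly0 _)) coef_sum.
have coefps_sum (F : 'I_n.+1 -> fps rat) : coefps (\sum_i F i) k = \sum_i coefps (F i) k.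
  by rewrite (big_morph (fun f : fps rat => coefps f k) (fun f g => erefl) (coefps0 _ k)).
rewrite coefpsM coefps_sum; apply: eq_bigr => i _.
have ni : (i + (n - i) = n)%N by have := ltn_ord i; lia.
by rewrite -{1}ni rev_polyM // coefM.
Qed.

Lemma homogD f g : homog (f + g) = homog f + homog g.
Proof.
by apply: fpsP => n; apply: fpsP => k; rewrite [LHS]/= rev_polyD coefD.
Qed.

Lemma homog0 : homog 0 = 0.
Proof.
apply: fpsP => n; apply: fpsP => k.
by rewrite -[LHS]/((rev_poly n (coefps 0 n))`_k) !coefps0 rev_poly0 coef0.
Qed.

Lemma homogN f : homog (- f) = - homog f.
Proof. by apply: (addrI (homog f)); rewrite -homogD !subrr homog0. Qed.

Lemma homogC (c : pol) : (size c <= 1)%N -> homog (fpsC c) = fpsC (fpsC c`_0).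
Proof.
move=> /size1_polyC->; apply: fpsP => -[|n]; apply: fpsP => k /=.
  by rewrite coef_poly coefC eqxx; case: k.
by rewrite rev_poly0 coef0 if_same.
Qed.

Lemma homog1 : homog 1 = 1.
Proof. by rewrite (homogC (c := 1)) ?size_poly1 // coefC. Qed.

Lemma homogX : homog y = varx * vary.
Proof.
apply: fpsP => n; apply: fpsP => k; rewrite mulrC coefpsXM -[LHS]/((rev_poly n _)`_k).
case: n => [|[|n]] /=; rewrite ?rev_poly0 ?coef0 ?if_same //.
by rewrite coef_poly coefC; case: k => [|[|k]].
Qed.

Lemma homogZX : homog (z * y) = vary.
Proof.
apply: fpsP => n; apply: fpsP => k; rewrite -[LHS]/((rev_poly n _)`_k) coefpsCM.
case: n => [|[|n]] /=; rewrite ?mulr0 ?rev_poly0 ?coef0 ?if_same //.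
by rewrite mulr1 coef_poly coefX; case: k => [|[|k]].
Qed.

Lemma degree_boundedD f g : degree_bounded f -> degree_bounded g ->
  degree_bounded (f + g).
Proof.
move=> bf bg n; apply: leq_trans (size_polyD _ _) _.
by rewrite geq_max bf bg.
Qed.

Lemma degree_boundedN f : degree_bounded f -> degree_bounded (- f).
Proof. by move=> bf n; rewrite size_polyN. Qed.

Lemma degree_boundedC (c : pol) : (size c <= 1)%N -> degree_bounded (fpsC c).
Proof. by move=> c1 [|n] //=; rewrite size_poly0. Qed.

Lemma degree_boundedX : degree_bounded y.
Proof. by move=> [|[|n]] /=; rewrite ?size_poly0 ?size_poly1. Qed.

Lemma degree_boundedZX : degree_bounded (z * y).
Proof.
move=> n; rewrite coefpsCM; case: n => [|[|n]] /=; rewrite ?mulr0 ?size_poly0 //.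
by rewrite mulr1 size_polyX.
Qed.

Lemma size_sum_mul_leq (f g : nat -> pol) n (I : finType) (s t : I -> nat) :
  (forall i, s i + t i <= n)%N ->
  (forall i, size (f (s i)) <= (s i).+1)%N -> (forall i, size (g (t i)) <= (t i).+1)%N ->
  (size (\sum_i f (s i) * g (t i))%R <= n.+1)%N.
Proof.
move=> st bf bg; apply: (leq_trans (size_sum _ _ _)); apply/bigmax_leqP => i _.
apply: leq_trans (size_polyMleq _ _) _.
have := bf i; have := bg i; have := st i; lia.
Qed.

Lemma degree_boundedM f g : degree_bounded f -> degree_bounded g ->
  degree_bounded (f * g).
Proof.
move=> bf bg n; apply: size_sum_mul_leq => // i.
have := ltn_ord i; lia.
Qed.

Lemma size_mulr2n_poly (p : pol) : size (p *+ 2) = size p.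
Proof. by rewrite -scaler_nat size_scale. Qed.

(** In [f ^+ 2] the coefficient of [f] of index [n.+1] occurs with factor 2, beside products of
    earlier ones whose degrees are bounded by induction. *)
Lemma degree_bounded_sqrt f : coefps f 0 = 1 -> degree_bounded (f ^+ 2) -> degree_bounded f.
Proof.
move=> f0 bf2; elim/ltn_ind => -[_|n IHn]; first by rewrite f0 size_poly1.
have : coefps f n.+1 *+ 2 = coefps (f ^+ 2) n.+1
    - \sum_(i < n) coefps f (lift ord0 (widen_ord (leqnSn n) i)) * coefps f (n - i).
  rewrite expr2 coefpsM big_ord_recl big_ord_recr /= subn0 subnn f0 mul1r mulr1 mulr2n.
  rewrite [X in _ + X - _]addrC [X in X - _]addrA; exact: esym (addrK _ _).
move=> e; rewrite -size_mulr2n_poly e.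
apply: leq_trans (size_polyD _ _) _; rewrite geq_max bf2 size_polyN /=.
apply: (size_sum_mul_leq (n := n.+1) (s := fun i : 'I_n => bump 0 i)
  (t := fun i : 'I_n => (n - i)%N)) => i.
- by have := ltn_ord i; rewrite /bump; lia.
- by apply: IHn; have := ltn_ord i; rewrite /bump; lia.
- by apply: IHn; have := ltn_ord i; lia.
Qed.

(** The same triangular argument, solving for the coefficients of [g]. Applied to [tubing_series],
    it bounds the number of tubes in a tubing by [n] through the functional equation. *)
Lemma degree_bounded_half_div f g : coefps f 0 = 1 -> degree_bounded f ->
  degree_bounded (2 * f * g) -> degree_bounded g.
Proof.
move=> f0 bf bh; elim/ltn_ind => n IHn.
have : coefps g n *+ 2 = coefps (2 * f * g) n
    - (\sum_(i < n) coefps f i.+1 * coefps g (n - i.+1)) *+ 2.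
  rewrite -mulrA mulr_natl coefpsMn coefpsM big_ord_recl f0 mul1r subn0.
  by rewrite mulrnDl addrK.
move=> e; rewrite -size_mulr2n_poly e.
apply: leq_trans (size_polyD _ _) _; rewrite geq_max bh size_polyN size_mulr2n_poly /=.
apply: (size_sum_mul_leq (s := fun i : 'I_n => i.+1)
  (t := fun i : 'I_n => (n - i.+1)%N)) => i.
- by have := ltn_ord i; lia.
- exact: bf.
- by apply: IHn; have := ltn_ord i; lia.
Qed.

Lemma degree_bounded1 : degree_bounded 1.
Proof. by apply: degree_boundedC; rewrite size_poly1. Qed.

Lemma homog_nat k : homog k%:R = k%:R.
Proof. by elim: k => [|k IHk]; rewrite ?homog0 // !mulrS homogD homog1 IHk. Qed.

Lemma degree_bounded_nat k : degree_bounded k%:R.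
Proof.
elim: k => [|k IHk].
  by move=> n; rewrite coefps0 size_poly0.
by rewrite mulrS; apply: degree_boundedD => //; exact: degree_bounded1.
Qed.

(** A second root [g] satisfies [(g - r) * (g + r) = 0], and [g + r] is invertible because its
    constant term is 2. *)
Lemma fps2_sqrtE (f r : fps2) : r ^+ 2 = f -> coefps (coefps r 0) 0 = 1 -> fps2_sqrt f = r.
Proof.
move=> r2 r0; rewrite /fps2_sqrt; case: xgetP => [g _ [/= g2 g0]|/(_ r)]; last by case.
have u : g + r \is a GRing.unit.
  apply/fps_unit_const/fps_unit_const; rewrite !coefpsD g0 r0.
  by rewrite unitfE.
apply/eqP; rewrite -subr_eq0 -(mulIr_eq0 _ (mulIr u)) -subr_sqr g2 r2 subrr //.
Qed.

Lemma homog_tubing_series :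
  homog tubing_series = (1 + (2 + varx) * vary) /
      (2 * fps2_sqrt (1 - 2 * (2 + varx) * vary + varx ^+ 2 * vary ^+ 2))
    + 1 / 2.
Proof.
have [r [r0 r2 rS]] := tubing_series_eq.
(* [z] alone violates the degree bound but [z * y] respects it, so each [z] is paired with a [y]
   before [homog] is applied. *)
have zy : (1 + 2 * z) * y = y + 2 * (z * y) by ring.
have b2 := degree_bounded_nat 2; have b1 := degree_bounded1.
have by_ := degree_boundedX; have bzy := degree_boundedZX.
have b2zy : degree_bounded (y + 2 * (z * y)) by apply/degree_boundedD/degree_boundedM.
have br : degree_bounded r.
  apply: degree_bounded_sqrt => //; rewrite r2 -mulrA zy expr2.
  apply: degree_boundedD; last exact: degree_boundedM.
  by apply: degree_boundedD => //; apply/degree_boundedN/degree_boundedM.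
have bS : degree_bounded tubing_series.
  apply: (degree_bounded_half_div r0 br); rewrite rS zy.
  by apply: degree_boundedD => //; apply: degree_boundedD.
have hzy : homog (y + 2 * (z * y)) = (2 + varx) * vary.
  by rewrite homogD homogM // homog_nat homogX homogZX; ring.
pose g := homog r.
have g2 : g ^+ 2 = 1 - 2 * (2 + varx) * vary + varx ^+ 2 * vary ^+ 2.
  rewrite expr2 -homogM // -expr2 r2 -mulrA zy expr2 !homogD homogN !homogM // hzy.
  by rewrite homog_nat homog1 homogX; ring.
have g00 : coefps g 0 = 1.
  apply: fpsP => k; rewrite coefps1 -[LHS]/((rev_poly 0 (coefps r 0))`_k) r0.
  by rewrite coef_poly coefC; case: k => [|k].
rewrite (fps2_sqrtE g2); last by rewrite g00 coefps1.
have u2 : (2 : fps2) \is a GRing.unit.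
  by apply/fps_unit_const/fps_unit_const; rewrite !coefpsD !coefps1 unitfE.
have ug : g \is a GRing.unit by apply: fps_unit_const; rewrite g00 unitr1.
have gS : 2 * g * homog tubing_series = g + 1 + (2 + varx) * vary.
  have := congr1 homog rS; rewrite zy (homogD (r + 1)) (homogD r) hzy homog1 homogM //;
    last exact: degree_boundedM.
  by rewrite homogM // homog_nat.
have u2g : 2 * g \is a GRing.unit by rewrite unitrM u2.
apply: (mulrI u2g); rewrite gS mulrDr mulrCA divrr // mulr1 div1r.
by rewrite mulrAC divrr // mul1r; ring.
Qed.

(** * Faces of simple polytopes *)

Local Open Scope classical_set_scope.

Lemma card_finset (T : finType) (D : {set T}) : ([set` D] #= `I_#|D|)%card.
Proof.
have inj : {in [set` D] &, injective (fun x => index x (enum D))}.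
  move=> x z; rewrite !inE /= -!(mem_enum D) => xD zD e.
  by rewrite -(nth_index x xD) e nth_index.
rewrite -(card_eql (inj_card_eq inj)).
suff -> : [set index x (enum D) | x in [set` D]] = `I_#|D| by [].
apply/seteqP; split=> k /= => [[x xD <-]|kD].
  by rewrite cardE index_mem mem_enum.
rewrite cardE in kD; case: (enum D) (@mem_enum _ D) (enum_uniq D) kD => // x s.
move=> memD u kD; exists (nth x (x :: s) k); last exact: index_uniq.
by rewrite -memD mem_nth.
Qed.

Section Dimension.
Variables (R : realType) (d : nat).
Implicit Types (P : set 'rV[R]_d).

Lemma has_dim_unique P k l : has_dim k P -> has_dim l P -> k = l.
Proof.
suff le k' l' : has_dim k' P -> has_dim l' P -> (k' <= l')%N.
  by move=> hk hl; apply/eqP; rewrite eqn_leq !le.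
move=> [x [V [Px Vf PV _]]] [x' [V' [Px' V'f _ V'P]]].
rewrite -(eqP Vf) -(eqP V'f); apply: mxrankS; apply/row_subP => i.
have -> : row i V = (x + row i V - x') - (x - x') by rewrite opprB addrA subrK addrC addKr.
by apply: addmx_sub; rewrite ?eqmx_opp ?V'P.
Qed.

(** Nested sets of equal dimension have the same affine hull, since their direction spaces are
    nested and of equal rank. *)
Lemma has_dim_sub_eq P Q k : has_dim k P -> has_dim k Q -> P `<=` Q ->
  exists x0 (V : 'M[R]_(k, d)),
    [/\ P x0, forall i, P (x0 + row i V) & forall x, Q x -> (x - x0 <= V)%MS].
Proof.
move=> [x [V [Px Vf PV PsV]]] [x' [V' [Px' V'f QV' QsV']]] PQ; exists x, V; split=> //.
have VV' : (V <= V')%MS.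
  apply/row_subP => i.
  have -> : row i V = (x + row i V - x') - (x - x') by rewrite opprB addrA subrK addrC addKr.
  by apply: addmx_sub; rewrite ?eqmx_opp QsV' //; apply: PQ.
have V'V : (V' <= V)%MS by rewrite -(geq_leqif (mxrank_leqif_sup VV')) (eqP Vf) (eqP V'f).
move=> w Qw; have -> : w - x = (w - x') - (x - x') by rewrite opprB addrA subrK.
by apply: submx_trans V'V; apply: addmx_sub; rewrite ?eqmx_opp QsV' //; apply: PQ.
Qed.

End Dimension.

Lemma small_common (R : realType) (I : finType) (Q : I -> R -> Prop) :
  (forall i, exists2 e, 0 < e & forall t, 0 <= t <= e -> Q i t) ->
  exists2 e, 0 < e & forall i t, 0 <= t <= e -> Q i t.
Proof.
move=> /(_ _)/cid2-/all_sig2[e e0 eQ].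
exists (\big[Order.min/1]_i e i); first by apply: lt_bigmin.
move=> i t /andP[t0 te]; apply: eQ; rewrite t0 /=.
by apply: le_trans te _; apply: bigmin_le_cond.
Qed.

(** * Irredundant systems of inequalities *)

Section Inequalities.
Variables (R : realType) (d n m : nat) (P : set 'rV[R]_d).
Variables (A : 'M[R]_(d, m)) (b : 'rV[R]_m) (x0 : 'rV[R]_d) (W : 'M[R]_(n, d)).
Implicit Types (x y w v : 'rV[R]_d) (i j : 'I_m) (I J : {set 'I_m}).

Definition form j x : R := (x *m A) 0 j.

(** The affine hull is kept apart from the inequalities, so that strict inequalities make sense even
    when [P] is not full-dimensional in the ambient space. *)
Definition satisfies I x := (x - x0 <= W)%MS /\ forall j, j \in I -> form j x <= b 0 j.

Lemma formD j x y : form j (x + y) = form j x + form j y.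
Proof. by rewrite /form mulmxDl mxE. Qed.
Lemma formN j x : form j (- x) = - form j x.
Proof. by rewrite /form mulNmx mxE. Qed.
Lemma formZ j t x : form j (t *: x) = t * form j x.
Proof. by rewrite /form -scalemxAl mxE. Qed.

Lemma formM j k (s : 'rV[R]_k) (V : 'M_(k, d)) :
  form j (s *m V) = \sum_i s 0 i * form j (row i V).
Proof.
rewrite mulmx_sum_row; elim/big_ind2: _ => [|x1 r1 x2 r2 <- <-|i _]; last by rewrite formZ.
  by rewrite /form mul0mx mxE.
by rewrite formD.
Qed.

Record irredundant I : Prop := Irredundant {
  irr_free : row_free W;
  irr_desc : forall x, P x <-> satisfies I x;
  irr_strict : exists2 x, (x - x0 <= W)%MS & forall j, j \in I -> form j x < b 0 j;
  irr_needed : forall j, j \in I ->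
    exists x, [/\ (x - x0 <= W)%MS, b 0 j < form j x
                & forall i, i \in I -> i != j -> form i x <= b 0 i];
  irr_bounded : exists M : R, forall x, P x -> forall k : 'I_d, `|x 0 k| <= M }.
End Inequalities.

(** A describing subset of least cardinality is irredundant. The barycentre of the [n.+1] points
    spanning the hull is strict: an inequality tight there would be tight at all these points, hence
    on the whole hull, and could not be violated at the point that shows it to be needed. *)
Lemma exists_irredundant (R : realType) (d n : nat) (P : set 'rV[R]_d) :
  is_polytope P -> has_dim n P ->
  exists m (A : 'M[R]_(d, m)) b x0 (W : 'M[R]_(n, d)) I, irredundant P A b x0 W I.
Proof.
move=> [[m [A [b PE]]] Pb] [x0 [W [Px0 Wf PW PsW]]].
exists m, A, b, x0, W.
pose Q (I : {set 'I_m}) := `[< forall x, P x <-> satisfies A b x0 W I x >].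
have QT : Q [set: 'I_m]%SET.
  apply/asboolP => x; split=> [Px|[_ H]]; first split; first exact: PsW.
    by move=> j _; move: Px; rewrite PE => /(_ j).
  by rewrite PE => j; apply: H; rewrite inE.
case: (arg_minnP (fun I : {set 'I_m} => #|I|) QT) => I /asboolP QI minI.
have needed j : j \in I -> exists x, [/\ (x - x0 <= W)%MS, b 0 j < form A j x
                & forall i, i \in I -> i != j -> form A i x <= b 0 i].
  move=> jI; apply: contrapT => nex.
  suff /minI : Q (I :\ j)%SET by rewrite (cardsD1 j I) jI ltnn.
  apply/asboolP => x; split=> [/QI[xW H]|[xW H]].
    by split=> // i; rewrite !inE => /andP[_]; exact: H.
  apply/QI; split=> // i iI; have [->|ij] := eqVneq i j; last by apply: H; rewrite !inE ij.
  rewrite leNgt; apply/negP => lt; apply: nex; exists x; split=> // i' i'I i'j.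
  by apply: H; rewrite !inE i'j.
exists I; split=> //.
pose c : R := (n.+1)%:R^-1.
have c0 : 0 < c by rewrite invr_gt0 ltr0Sn.
have cn : c * (n.+1)%:R = 1 by rewrite mulVf // pnatr_eq0.
exists (x0 + (c *: const_mx 1) *m W) => [|j jI].
  by rewrite addrC addKr submxMl.
have le1 i : form A j (x0 + row i W) <= b 0 j by have /QI[_] := PW i; apply.
have le0 : form A j x0 <= b 0 j by have /QI[_] := Px0; apply.
have sumE : form A j (x0 + (c *: const_mx 1) *m W) =
    b 0 j - c * ((b 0 j - form A j x0) + \sum_i (b 0 j - form A j (x0 + row i W))).
  rewrite formD formM (eq_bigr (fun i => c * form A j (row i W))); last first.
    by move=> i _; rewrite !mxE mulr1.
  rewrite -mulr_sumr.
  under [X in _ = _ - c * (_ + X)]eq_bigr do rewrite formD opprD addrA.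
  rewrite sumrB sumr_const card_ord -[X in _ + (X - _)]mulr_natl.
  have -> : b 0 j - form A j x0 + (n%:R * (b 0 j - form A j x0) - \sum_i form A j (row i W))
    = n.+1%:R * (b 0 j - form A j x0) - \sum_i form A j (row i W).
    by rewrite -[n.+1]addn1 natrD; ring.
  by rewrite mulrBr mulrA cn; ring.
have ge0 : 0 <= (b 0 j - form A j x0) + \sum_i (b 0 j - form A j (x0 + row i W)).
  by rewrite addr_ge0 ?sumr_ge0 ?subr_ge0 // => i _; rewrite subr_ge0.
rewrite sumE ltrBlDr ltrDl mulr_gt0 // lt_neqAle ge0 andbT eq_sym.
rewrite paddr_eq0 ?subr_ge0 ?sumr_ge0 // => [|i _]; last by rewrite subr_ge0.
apply/negP => /andP[]; rewrite subr_eq0 => /eqP b0.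
rewrite psumr_eq0 => [/allP all0|i _]; last by rewrite subr_ge0.
have [z [/submxP[s zE] bz _]] := needed j jI.
move: bz; rewrite -(subrK x0 z) zE formD formM big1 ?add0r ?b0 ?ltxx // => i _.
have := all0 i (mem_index_enum i); rewrite subr_eq0 formD b0 => /eqP/eqP.
by rewrite eq_sym addrC -subr_eq0 addrK => /eqP->; rewrite mulr0.
Qed.

(** * Tight faces, vertices and facets *)

Section Faces.
Variables (R : realType) (d n m : nat) (P : set 'rV[R]_d).
Variables (A : 'M[R]_(d, m)) (b : 'rV[R]_m) (x0 : 'rV[R]_d) (W : 'M[R]_(n, d)).
Variable I : {set 'I_m}.
Implicit Types (x y w v : 'rV[R]_d) (i j : 'I_m) (J : {set 'I_m}).
Hypothesis irr : irredundant P A b x0 W I.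

Local Notation l := (form A).

Definition tight_face J : set 'rV[R]_d :=
  [set x | P x /\ forall j, j \in J -> l j x = b 0 j].

Definition active x : {set 'I_m} := [set j in I | l j x == b 0 j]%SET.

Lemma inP x : P x <-> (x - x0 <= W)%MS /\ forall j, j \in I -> l j x <= b 0 j.
Proof. exact: (irr_desc irr). Qed.

Lemma in_le x j : P x -> j \in I -> l j x <= b 0 j.
Proof. by move=> /inP[_]; apply. Qed.

Lemma sub_dir x y : P x -> P y -> (x - y <= W)%MS.
Proof.
move=> /inP[xW _] /inP[yW _]; have -> : x - y = (x - x0) - (y - x0).
  by rewrite opprB addrA subrK.
by apply: addmx_sub; rewrite ?eqmx_opp.
Qed.

Lemma activeP x j : reflect (j \in I /\ l j x = b 0 j) (j \in active x).
Proof. by rewrite inE; apply: (iffP andP) => -[jI /eqP]. Qed.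

(** Active forms do not increase along [w], and each of the finitely many inactive ones has positive
    slack. *)
Lemma small_step x w : P x -> (w <= W)%MS ->
  (forall j, j \in active x -> l j w <= 0) ->
  exists2 e, 0 < e & forall t, 0 <= t <= e -> P (x + t *: w).
Proof.
move=> Px wW hw.
have [|e e0 eP] := @small_common R 'I_m (fun j t => j \in I -> l j x + t * l j w <= b 0 j).
  move=> j; case: (boolP (j \in active x)) => [jx|njx].
    exists 1 => // t /andP[t0 _] jI; have /activeP[_ ->] := jx.
    by rewrite gerDl mulr_ge0_le0 // hw.
  case: (boolP (j \in I)) => [jI|njI]; last by exists 1 => // t _ jI; rewrite jI in njI.
  have s0 : 0 < b 0 j - l j x.
    by rewrite subr_gt0 lt_neqAle in_le // andbT; move: njx; rewrite inE jI.
  (* The summand 1 keeps the denominator positive when [l j w = 0]. *)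
  exists ((b 0 j - l j x) / (`|l j w| + 1)) => [|t /andP[t0 te] _].
    by rewrite divr_gt0 // ltr_wpDl.
  rewrite addrC -lerBrDr; apply: le_trans (ler_wpM2l t0 (ler_norm _)) _.
  rewrite ler_pdivlMr ?ltr_wpDl // in te.
  by apply: le_trans te; rewrite ler_wpM2l // lerDl.
exists e => // t te; apply/inP; split.
  rewrite addrAC; apply: addmx_sub; first by have /inP[] := Px.
  exact: scalemx_sub.
by move=> j jI; rewrite formD formZ; apply: eP.
Qed.

Lemma is_face_tight J x : J \subset I -> tight_face J x -> is_face P (tight_face J).
Proof.
move=> /fintype.subsetP JI [Px xJ]; split; first by exists x.
exists (\sum_(j in J) col j A).
have cE y : (y *m (\sum_(j in J) col j A)) 0 0 = \sum_(j in J) l j y.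
  rewrite mulmx_sumr summxE; apply: eq_bigr => j _.
  by rewrite /form !mxE; apply: eq_bigr => k _; rewrite !mxE.
apply/seteqP; split=> y [Py yJ]; split=> //.
  move=> z Pz; rewrite !cE; apply: ler_sum => j jJ; rewrite yJ //.
  exact: in_le (JI _ jJ).
move=> j jJ; apply/eqP; rewrite eq_le in_le ?JI //=.
have := yJ x Px; rewrite !cE (bigD1 j) //= [leRHS](bigD1 j) //= (xJ j jJ).
apply: contraTT; rewrite -!ltNge => lt; apply: ltr_leD => //.
apply: ler_sum => i /andP[iJ _]; rewrite xJ //; exact: in_le (JI _ iJ).
Qed.

(** Vertices are taken algebraically: the active forms separate the directions of the affine
    hull. *)
Definition is_vertex v := P v /\
  forall w, (w <= W)%MS -> (forall j, j \in active v -> l j w = 0) -> w = 0.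

(** A point that is not a vertex can move along a line on which its active forms are constant until
    a new inequality becomes tight. Boundedness makes this happen, and the number of inactive
    inequalities drops. *)
Lemma exists_vertex J x : J \subset I -> tight_face J x ->
  exists2 v, tight_face J v & is_vertex v.
Proof.
move=> JI; have [k] := ubnP (#|I| - #|active x|)%N; elim: k x => // k IHk x.
rewrite ltnS => lek [Px xJ].
have [vx|nvx] := pselect (is_vertex x); first by exists x.
have [w [wW aw w0]] :
    exists w, [/\ (w <= W)%MS, forall j, j \in active x -> l j w = 0 & w != 0].
  apply: contrapT => nex; apply: nvx; split=> // w wW aw; apply: contrapT => /eqP w0.
  by apply: nex; exists w.
pose K := [pred j | (j \in I) && (0 < l j w)].
have [j0 Kj0] : exists j, K j.
  apply: contrapT => nK.
  have Pt t : 0 <= t -> P (x + t *: w).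
    move=> t0; apply/inP; split.
      by rewrite addrAC; apply: addmx_sub; [have /inP[] := Px | exact: scalemx_sub].
    move=> j jI; rewrite formD formZ; apply: le_trans (in_le Px jI).
    rewrite gerDl mulr_ge0_le0 // leNgt; apply/negP => lj; apply: nK; exists j.
    by rewrite /= jI.
  have [M Mb] := irr_bounded irr.
  have /rV0Pn[i wi] := w0.
  have M0 : 0 <= M := le_trans (normr_ge0 _) (Mb x Px i).
  (* This step moves coordinate [i] by [M + M + 1] in absolute value, hence beyond the bound [M]. *)
  have t0 : 0 <= (M + M + 1) / `|w 0 i| by rewrite divr_ge0 // !addr_ge0.
  have := Mb _ (Pt _ t0) i; rewrite !mxE.
  have := Mb x Px i => xi.
  apply/negP; rewrite -ltNge addrC; apply: lt_le_trans (lerB_normD _ _).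
  rewrite normrM (ger0_norm t0) divfK ?normr_eq0 //; lra.
have [j /andP[jI lj] jmin] := arg_minP (fun j => (b 0 j - l j x) / l j w) Kj0.
pose t := (b 0 j - l j x) / l j w.
have t0 : 0 <= t by rewrite divr_ge0 ?subr_ge0 ?in_le // ltW.
have Px' : P (x + t *: w).
  apply/inP; split.
    by rewrite addrAC; apply: addmx_sub; [have /inP[] := Px | exact: scalemx_sub].
  move=> i iI; rewrite formD formZ.
  have [li|li] := ltP 0 (l i w).
    by rewrite addrC -lerBrDr -ler_pdivlMr // jmin //= iI.
  by apply: le_trans (in_le Px iI); rewrite gerDl mulr_ge0_le0.
apply: (IHk (x + t *: w)); last first.
  split=> // i iJ; rewrite formD formZ aw ?mulr0 ?addr0 ?xJ //.
  by apply/activeP; split; [exact: (fintype.subsetP JI) | exact: xJ].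
apply: leq_trans lek; apply: ltn_sub2l.
  apply: proper_card; apply/properP; split; first by apply/fintype.subsetP => i /activeP[].
  by exists j => //; apply/activeP => -[_ e]; move: lj; rewrite aw ?ltxx //; apply/activeP.
apply: proper_card; apply/properP; split.
  apply/fintype.subsetP => i ix; have /activeP[iI e] := ix; apply/activeP; split=> //.
  by rewrite formD formZ aw // mulr0 addr0.
exists j.
  by apply/activeP; split=> //; rewrite formD formZ /t mulfVK ?gt_eqF // addrC subrK.
by apply/negP => jx; move: lj; rewrite aw ?ltxx.
Qed.

Lemma tight_active v : is_vertex v -> tight_face (active v) = [set v].
Proof.
move=> [Pv vv]; apply/seteqP; split=> [x [Px xa]|x ->] /=; last first.
  by split=> // j /activeP[].
apply/eqP; rewrite -subr_eq0; apply/eqP/vv; first exact: sub_dir.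
by move=> j jv; rewrite formD formN xa //; have /activeP[_ ->] := jv; rewrite subrr.
Qed.

Lemma face0_vertex v : is_vertex v -> faces P 0 [set v].
Proof.
move=> vv; split.
  rewrite -tight_active //; apply: (is_face_tight (x := v)).
    by apply/fintype.subsetP => i /activeP[].
  by rewrite tight_active.
exists v, 0; split=> //; first by rewrite /row_free mxrank0.
  by move=> [].
by move=> x /= ->; rewrite subrr sub0mx.
Qed.

(** The segment from a strict point to a point violating only [j] crosses the hyperplane of [j]
    where the other inequalities are still strict. *)
Lemma facet_point j : j \in I -> exists p, [/\ P p, l j p = b 0 j
   & forall i, i \in I -> i != j -> l i p < b 0 i].
Proof.
move=> jI; have [xs xsW xslt] := irr_strict irr.
have [z [zW jz zle]] := irr_needed irr jI.
pose t := (b 0 j - l j xs) / (l j z - l j xs).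
have den : 0 < l j z - l j xs by rewrite subr_gt0 (lt_trans (xslt j jI)).
have t0 : 0 < t by rewrite divr_gt0 // subr_gt0 xslt.
have t1 : t < 1 by rewrite ltr_pdivrMr // mul1r ltrD2r.
have pj : l j (xs + t *: (z - xs)) = b 0 j.
  by rewrite formD formZ formD formN /t mulfVK ?gt_eqF // addrC subrK.
have plt i : i \in I -> i != j -> l i (xs + t *: (z - xs)) < b 0 i.
  move=> iI ij; rewrite formD formZ formD formN.
  have := xslt i iI; have := zle i iI ij; nra.
exists (xs + t *: (z - xs)); split=> //; apply/inP; split.
  rewrite addrAC; apply: addmx_sub => //; apply: scalemx_sub.
  have -> : z - xs = (z - x0) - (xs - x0) by rewrite opprB addrA subrK.
  by apply: addmx_sub; rewrite ?eqmx_opp.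
by move=> i iI; have [->|ij] := eqVneq i j; [rewrite pj | apply/ltW/plt].
Qed.

(** In the coordinates given by [W] the form of [j] is a nonzero column [u], whose kernel has rank
    [n.-1]. At the point of [facet_point] only [j] is active, so small steps along a basis of this
    kernel stay in the face. *)
Lemma facet_dim j : j \in I ->
  exists k, n = k.+1 /\ has_dim k (tight_face [set j]%SET).
Proof.
move=> jI; have [p [Pp pj plt]] := facet_point jI.
pose u : 'cV_n := W *m col j A.
have formW (s : 'rV_n) : l j (s *m W) = (s *m u) 0 0.
  rewrite /form /u mulmxA -!(mulmxA s) !mxE; apply: eq_bigr => k _.
  by rewrite !mxE; congr (_ * _); apply: eq_bigr => k' _; rewrite !mxE.
have u0 : u != 0.
  have [xs xsW xslt] := irr_strict irr.
  have /submxP[s sE] : (p - xs <= W)%MS.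
    have -> : p - xs = (p - x0) - (xs - x0) by rewrite opprB addrA subrK.
    by apply: addmx_sub; rewrite ?eqmx_opp //; have /inP[] := Pp.
  apply/eqP => u0; have := formW s; rewrite -sE u0 mulmx0 mxE formD formN pj => /eqP.
  by rewrite subr_eq0 gt_eqF // xslt.
have ru : \rank u = 1%N.
  by apply/eqP; rewrite eqn_leq rank_leq_col lt0n mxrank_eq0.
pose K := row_base (kermx u).
have rk : \rank (kermx u) = n.-1 by rewrite mxrank_ker ru subn1.
exists n.-1; split; first by have := rank_leq_row u; rewrite ru; case: (n).
rewrite -rk; pose V := K *m W.
have Vf : row_free V.
  by rewrite /row_free /V mxrankMfree ?(irr_free irr) // eq_row_base.
have Vj k : l j (row k V) = 0.
  rewrite row_mul formW.
  have /sub_kermxP-> : (row k K <= kermx u)%MS.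
    by rewrite (submx_trans (row_sub _ _)) ?eq_row_base.
  by rewrite mxE.
have [|e e0 eP] :=
  @small_common R _ (fun (i : 'I_(\rank (kermx u))) t => P (p + t *: row i V)).
  move=> i; apply: small_step => // [|i' /activeP[i'I i'p]].
    by rewrite row_mul submxMl.
  have [->|ij] := eqVneq i' j; first by rewrite Vj.
  by have := plt i' i'I ij; rewrite i'p ltxx.
exists p, (e *: V); split.
- by split=> // i; rewrite inE => /eqP->.
- by rewrite /row_free (mxrank_scale_nz _ (lt0r_neq0 e0)); exact: Vf.
- move=> i; have -> : row i (e *: V) = e *: row i V by apply/rowP => k; rewrite !mxE.
  split; first by apply: eP; rewrite ltW // lexx.
  by move=> i' /set1P->; rewrite formD formZ Vj mulr0 addr0.
move=> x [Px xj]; rewrite eqmx_scale ?gt_eqF //.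
have /submxP[s sE] := sub_dir Px Pp; rewrite sE; apply: submxMr; rewrite eq_row_base.
apply/sub_kermxP/rowP => k; rewrite ord1 -formW -sE mxE formD formN pj xj ?subrr //.
exact/set1P.
Qed.

Lemma tight_face1_inj i j : i \in I -> j \in I ->
  tight_face [set i]%SET `<=` tight_face [set j]%SET -> i = j.
Proof.
move=> iI jI sub; have [p [Pp pj plt]] := facet_point iI.
have [_ /(_ j)] : tight_face [set j]%SET p by apply: sub; split=> // k /set1P->.
rewrite finset.set11 => /(_ isT) pj'; apply/eqP; rewrite eq_sym; apply: contraT => ji.
by have := plt j jI ji; rewrite pj' ltxx.
Qed.

Hypothesis dimP : has_dim n P.

Lemma facet_tight j : j \in I -> facets P (tight_face [set j]%SET).
Proof.
move=> jI; have [k [nk hk]] := facet_dim jI; exists k; rewrite -nk; split=> //; split=> //.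
have [p [Pp pj _]] := facet_point jI.
by apply: (is_face_tight (x := p)); [rewrite finset.sub1set | split=> // i /set1P->].
Qed.

(* Moving a little from [x] away from [y] stays in [P], so a functional maximal at [x]
   is not smaller at [y]. *)
Lemma face_active F x y : is_face P F -> F x -> P y -> active x \subset active y -> F y.
Proof.
move=> [_ [c ->]] [Px xmax] Py /fintype.subsetP xy; split=> // z Pz.
apply: le_trans (xmax z Pz) _.
have [j jx|e e0 eP] := @small_step x (x - y) Px (sub_dir Px Py).
  have /activeP[_ jy] := xy j jx; have /activeP[_ jx'] := jx.
  by rewrite formD formN jx' jy subrr.
have /xmax : P (x + e *: (x - y)) by apply: eP; rewrite ltW // lexx.
rewrite -!/(form c 0 _) formD formZ formD formN gerDl pmulr_rle0 //.
by rewrite subr_le0.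
Qed.

(** A point [y] of [G] with the fewest active inequalities has at least one, since otherwise [G]
    would be all of [P]. An inequality active at [y] is tight on all of [G], and equality of
    dimensions forces [G] to be its tight face. *)
Lemma facetE G : facets P G -> exists2 j, j \in I & G = tight_face [set j]%SET.
Proof.
move=> [k [dimk [faceG dimG]]].
have nk : n = k.+1 := has_dim_unique dimP dimk.
have [[g0 Gg0] [c GE]] := faceG.
have GP x : G x -> P x by rewrite GE => -[].
have exy : exists a, `[< exists2 y, G y & #|active y| = a >].
  by exists #|active g0|; apply/asboolP; exists g0.
have [y Gy ymin] : exists2 y, G y & forall g, G g -> (#|active y| <= #|active g|)%N.
  case: (ex_minnP exy) => a /asboolP[y Gy <-] amin; exists y => // g Gg.
  by apply: amin; apply/asboolP; exists g.
have [ay0|[j jy]] := set_0Vmem (active y).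
  have GeqP : G = P.
    apply/seteqP; split=> [x /GP//|x Px].
    by apply: (face_active faceG Gy Px); rewrite ay0 finset.sub0set.
  by rewrite GeqP in dimG; have := has_dim_unique dimk dimG; lia.
have /activeP[jI yj] := jy.
have Gj : G `<=` tight_face [set j]%SET.
  move=> g Gg; split; first exact: GP.
  (* At the midpoint [h] an inequality is active only if it is so at [y] and [g]. Minimality at [y]
     makes [j] active at [h], hence at [g]. *)
  move=> i /set1P->; pose h := y + 2^-1 *: (g - y).
  have hE q (f : 'M[R]_(d, q)) r : form f r h = 2^-1 * form f r y + 2^-1 * form f r g.
    by rewrite formD formZ formD formN; field.
  have Py := GP y Gy; have Pg := GP g Gg.
  have Ph : P h.
    apply/inP; split=> [|i' i'I].
      rewrite addrAC; apply: addmx_sub; first by have /inP[] := Py.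
      by apply/scalemx_sub/sub_dir.
    by rewrite hE; have := in_le Py i'I; have := in_le Pg i'I; lra.
  have Gh : G h.
    move: Gy Gg; rewrite GE => -[_ ymax] [_ gmax]; split=> // z Pz.
    by have := ymax z Pz; have := gmax z Pz; rewrite -!/(form c 0 _) hE; lra.
  have hy : active h \subset active y.
    apply/fintype.subsetP => i' /activeP[i'I hi']; apply/activeP; split=> //.
    by move: hi'; rewrite hE; have := in_le Py i'I; have := in_le Pg i'I; lra.
  have /activeP[_] : j \in active h.
    suff -> : active h = active y by [].
    by apply/eqP; rewrite eqEcard hy ymin.
  by rewrite hE yj; lra.
exists j => //; apply/seteqP; split=> // x.
have [k' [nk' dimF]] := facet_dim jI.
have kk' : k' = k by move: nk'; rewrite nk => -[].
rewrite kk' in dimF; have [x1 [V [Gx1 GV FV]]] := has_dim_sub_eq dimG dimF Gj.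
move=> Fx; have /submxP[s sE] := FV x Fx; have Px : P x by case: Fx.
(* [c] is constant on [G], so it vanishes on the directions of the common affine hull. *)
have cV r : form c 0 (row r V) = 0.
  have := Gx1; have := GV r; rewrite GE => -[PV maxV] [Px1 max1].
  have := maxV _ Px1; have := max1 _ PV; rewrite -!/(form c 0 _) formD.
  move: (form c 0 x1) (form c 0 _) => p q; lra.
rewrite GE; split=> // z Pz; move: Gx1; rewrite GE => -[_ /(_ z Pz)] /le_trans; apply.
by rewrite -!/(form c 0 _) -[x](subrK x1) sE formD formM big1 ?add0r // => i _; rewrite cV mulr0.
Qed.

End Faces.

(** * Faces of simple polytopes as sets of facets *)

Section SimpleFaces.
Variables (R : realType) (d n m : nat) (P : set 'rV[R]_d).
Variables (A : 'M[R]_(d, m)) (b : 'rV[R]_m) (x0 : 'rV[R]_d) (W : 'M[R]_(n, d)).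
Variable I : {set 'I_m}.
Implicit Types (x y w v : 'rV[R]_d) (i j : 'I_m) (J : {set 'I_m}).
Hypothesis irr : irredundant P A b x0 W I.
Hypothesis dimP : has_dim n P.
Hypothesis simpleP :
  forall F, faces P 0 F -> ([set G | facets P G /\ F `<=` G] #= `I_n)%card.

Local Notation l := (form A).
Local Notation tight := (tight_face P A b).
Local Notation act := (active A b I).
Local Notation vertex := (is_vertex P A b W I).

Lemma card_active v : vertex v -> #|act v| = n.
Proof.
move=> vv; have [Pv _] := vv.
have := simpleP (face0_vertex irr vv).
have -> : [set G | facets P G /\ [set v] `<=` G]
    = [set tight [set j]%SET | j in [set` act v]].
  apply/seteqP; split=> [G [/(facetE irr dimP)[j jI ->] vj]|_ [j jv <-]] /=.
    exists j => //=; apply/activeP; split=> //.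
    by have [_] := vj v erefl; apply; rewrite finset.set11.
  have /activeP[jI vj] := jv; split; first exact: (facet_tight irr).
  by move=> _ ->; split=> // i /set1P->.
have inj : {in [set` act v] &, injective (fun j => tight [set j]%SET)}.
  move=> i j; rewrite !inE /= => /activeP[iI _] /activeP[jI _] e.
  by apply: (tight_face1_inj irr iI jI); rewrite e.
rewrite (card_eql (inj_card_eq inj)) (card_eql (card_finset _)).
by move=> /card_eq_II.
Qed.

(* [s] enumerates the facets through [v] and the rows of [T] are the edge directions
   at [v], the dual basis (up to sign) of the inequalities active at [v]. *)
Lemma vertex_edges v : vertex v -> exists (s : 'I_n -> 'I_m) (T : 'M[R]_(n, d)),
  [/\ injective s, (act v = [set s k | k : 'I_n])%SET, row_free T /\ (T <= W)%MS,
    forall k k', l (s k') (row k T) = - (k == k')%:R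
  & forall w, (w <= W)%MS -> w = (\row_k (- l (s k) w)) *m T].
Proof.
move=> vv; have [Pv vW] := vv; have cn := card_active vv.
pose s k : 'I_m := enum_val (cast_ord (esym cn) k).
have s_inj : injective s by move=> k k' /enum_val_inj/cast_ord_inj.
have sE : (act v = [set s k | k : 'I_n])%SET.
  apply/setP => j; apply/idP/imsetP => [jv|[k _ ->]]; last exact: enum_valP.
  exists (cast_ord cn (enum_rank_in jv j)) => //.
  by rewrite /s cast_ordK enum_rankK_in.
(* [N] expresses the active forms in the coordinates of [W]. It is invertible because these forms
   kill no nonzero direction at a vertex. *)
pose N : 'M[R]_n := \matrix_(i, k) l (s k) (row i W).
have NE (r : 'rV_n) k : (r *m N) 0 k = l (s k) (r *m W).
  by rewrite formM mxE; apply: eq_bigr => i _; rewrite mxE.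
have Nu : N \in unitmx.
  rewrite -row_free_unit; apply: inj_row_free => r rN.
  apply: (row_free_inj (irr_free irr)); rewrite mul0mx; apply: vW; first exact: submxMl.
  by move=> j; rewrite sE => /imsetP[k _ ->]; rewrite -NE rN mxE.
exists s, (- invmx N *m W); split=> //.
- split; last exact: submxMl.
  rewrite /row_free mxrankMfree ?(irr_free irr) //.
  by rewrite -/(row_free _) row_free_unit -scaleN1r unitmxZ ?unitrN1 // unitmx_inv.
- move=> k k'; rewrite row_mul -NE -row_mul mulNmx mulVmx //.
  by rewrite !mxE.
move=> _ /submxP[r ->].
have -> : \row_k (- l (s k) (r *m W)) = - (r *m N).
  by apply/rowP => k; rewrite [LHS]mxE -NE [RHS]mxE.
by rewrite mulNmx mulNmx mulmxN opprK mulmxA mulmxK.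
Qed.

Lemma vertex_steps v (s : 'I_n -> 'I_m) (T : 'M[R]_(n, d)) : vertex v ->
  (act v = [set s k | k : 'I_n])%SET -> (T <= W)%MS ->
  (forall k k', l (s k') (row k T) = - (k == k')%:R) ->
  exists2 e, 0 < e & forall k, P (v + e *: row k T).
Proof.
move=> [Pv _] sE TW Ts.
have [k|e e0 eP] := @small_common R _ (fun k t => P (v + t *: row k T)).
  apply: (small_step irr) => // [|j]; first exact: submx_trans (row_sub _ _) TW.
  by rewrite sE => /imsetP[k' _ ->]; rewrite Ts oppr_le0.
by exists e => // k; apply: eP; rewrite ltW // lexx.
Qed.

Lemma tight_vertex v J : vertex v -> J \subset act v -> tight J v.
Proof. by move=> [Pv _] /fintype.subsetP Jv; split=> // j /Jv/activeP[]. Qed.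

(** The face is spanned from [v] by the edges that belong to active inequalities outside [J]. *)
Lemma has_dim_tight v J : vertex v -> J \subset act v ->
  has_dim (n - #|J|) (tight J).
Proof.
move=> vv Jv; have [Pv vJ] := tight_vertex vv Jv.
have [s [T [s_inj sE [Tf TW] Ts Tw]]] := vertex_edges vv.
have [e e0 eP] := vertex_steps vv sE TW Ts.
pose K := [set k | s k \notin J]%SET.
have KJ : #|K| = (n - #|J|)%N.
  have -> : (J = s @: ~: K)%SET.
    apply/setP => j; apply/idP/imsetP => [jJ|[k]]; last by rewrite !inE negbK => ? ->.
    have := fintype.subsetP Jv j jJ; rewrite sE => /imsetP[k _ jk].
    by exists k; rewrite // !inE negbK -jk.
  by rewrite card_imset // -[n in (n - _)%N]card_ord -(cardsC K) addnK.
rewrite -KJ; pose f (r : 'I_#|K|) := enum_val r.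
have f_inj : injective f by exact: enum_val_inj.
have fK r : s (f r) \notin J by have := enum_valP r; rewrite inE.
exists v, (e *: rowsub f T); split.
- by split.
- rewrite /row_free (mxrank_scale_nz _ (lt0r_neq0 e0)) -/(row_free _).
  have /row_freeP[B TB] := Tf; apply/row_freeP; exists (colsub f B).
  by rewrite -mxsub_mul TB; apply/matrixP => r r'; rewrite !mxE (inj_eq f_inj).
- move=> r; have -> : row r (e *: rowsub f T) = e *: row (f r) T.
    by apply/rowP => k; rewrite !mxE.
  split; first exact: eP.
  move=> j jJ; rewrite formD formZ vJ //.
  have := fintype.subsetP Jv j jJ; rewrite sE => /imsetP[k _ jk].
  rewrite jk Ts; have [fk|_] := eqVneq (f r) k; last by rewrite oppr0 mulr0 addr0.
  by have := fK r; rewrite fk -jk jJ.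
move=> x [Px xJ]; rewrite eqmx_scale ?gt_eqF // (Tw _ (sub_dir irr Px Pv)).
rewrite mulmx_sum_row; apply: summx_sub => k _.
have [kK|] := boolP (k \in K).
  have -> : row k T = row (enum_rank_in kK k) (rowsub f T).
    by apply/rowP => c; rewrite !mxE /f enum_rankK_in.
  by apply: scalemx_sub; exact: row_sub.
rewrite inE negbK => kJ; rewrite mxE formD formN vJ // xJ // subrr oppr0 scale0r.
exact: sub0mx.
Qed.

(** If [i] were not in [J], a small step from [v] along the edge of [i] would stay in the face of
    [J] and leave that of [i]. *)
Lemma tight_mem v J i : vertex v -> J \subset act v -> i \in I ->
  tight J `<=` tight [set i]%SET -> i \in J.
Proof.
move=> vv Jv iI sub; have [Pv vJ] := tight_vertex vv Jv.
have [s [T [s_inj sE [Tf TW] Ts Tw]]] := vertex_edges vv.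
have [e e0 eP] := vertex_steps vv sE TW Ts.
have vi : l i v = b 0 i.
  by have [_] := sub v (tight_vertex vv Jv); apply; rewrite finset.set11.
have : i \in act v by apply/activeP.
rewrite sE => /imsetP[k _ ik]; apply: contraT => iJ.
have [|_ /(_ i)] := sub (v + e *: row k T).
  split=> // j jJ; rewrite formD formZ vJ //.
  have := fintype.subsetP Jv j jJ; rewrite sE => /imsetP[k' _ jk].
  rewrite jk Ts; have [kk'|_] := eqVneq k k'; last by rewrite oppr0 mulr0 addr0.
  by move: iJ; rewrite ik kk' -jk jJ.
rewrite finset.set11 => /(_ isT); rewrite formD formZ vi ik Ts eqxx mulrN mulr1.
by move/eqP; rewrite -subr_eq0 addrAC subrr add0r oppr_eq0 gt_eqF.
Qed.

(** At a vertex [v] of the face the functional has nonpositive slope along every edge. Its value at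
    [y] is that at [v] minus a sum of products of slack and negated slope, all nonnegative. So [y]
    is maximal exactly when the slacks with nonzero slope vanish, and these make up [J]. *)
Lemma face_tight F : is_face P F -> exists v J, [/\ vertex v, J \subset act v & F = tight J].
Proof.
move=> faceF; have [[x Fx] [c FE]] := faceF.
have Px : P x by move: Fx; rewrite FE => -[].
have [||v [Pv vx] vv] := @exists_vertex _ _ _ _ _ _ _ _ _ _ irr (act x) x.
- by apply/fintype.subsetP => j /activeP[].
- by split=> // j /activeP[].
have Fv : F v.
  apply: (face_active irr faceF Fx Pv); apply/fintype.subsetP => j jx.
  by apply/activeP; split; [have /activeP[] := jx | exact: vx].
have [s [T [s_inj sE [Tf TW] Ts Tw]]] := vertex_edges vv.
have [e e0 eP] := vertex_steps vv sE TW Ts.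
have cmax y : P y -> form c 0 y <= form c 0 v by move: Fv; rewrite FE => -[_]; apply.
have cT k : form c 0 (row k T) <= 0.
  have := cmax _ (eP k); rewrite formD formZ gerDl pmulr_rle0 //.
have sI k : s k \in I.
  have : s k \in act v by rewrite sE; apply/imsetP; exists k.
  by case/activeP.
have vs k : l (s k) v = b 0 (s k).
  have : s k \in act v by rewrite sE; apply/imsetP; exists k.
  by case/activeP.
have cE y : P y -> form c 0 y =
    form c 0 v - \sum_k (b 0 (s k) - l (s k) y) * - form c 0 (row k T).
  move=> Py; rewrite -{1}(subrK v y) formD (Tw _ (sub_dir irr Py Pv)) formM addrC.
  congr (_ + _); rewrite -sumrN; apply: eq_bigr => k _.
  by rewrite mxE formD formN vs; ring.
have terms y k : P y -> 0 <= (b 0 (s k) - l (s k) y) * - form c 0 (row k T).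
  by move=> Py; rewrite mulr_ge0 ?oppr_ge0 // subr_ge0 (in_le irr).
exists v, [set s k | k in [pred k | form c 0 (row k T) != 0]]%SET; split=> //.
  by apply/fintype.subsetP => _ /imsetP[k _ ->]; rewrite sE; apply/imsetP; exists k.
apply/seteqP; split=> y.
  rewrite FE => -[Py ymax]; split=> // _ /imsetP[k ck ->].
  have : \sum_k (b 0 (s k) - l (s k) y) * - form c 0 (row k T) = 0.
    apply/eqP; rewrite eq_le sumr_ge0 ?andbT => [|i _]; last exact: terms.
    by have := ymax v Pv; rewrite -!/(form c 0 _) (cE y Py); lra.
  move/eqP; rewrite psumr_eq0 => [/allP/(_ k (mem_index_enum k))|i _]; last exact: terms.
  by rewrite mulf_eq0 oppr_eq0 (negPf ck) orbF subr_eq0 => /eqP->.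
move=> [Py ys]; rewrite FE; split=> // z Pz; rewrite -!/(form c 0 _).
rewrite (cE y Py) big1 ?subr0 ?cmax // => k _.
have [->|ck] := eqVneq (form c 0 (row k T)) 0; first by rewrite oppr0 mulr0.
by rewrite ys ?subrr ?mul0r //; apply/imsetP; exists k.
Qed.

(** In terms of indices, these are the simplices of [dual_complex P]. *)
Definition valid J := J \subset I /\ tight J !=set0.

Lemma valid_vertex J : valid J -> exists2 v, vertex v & J \subset act v.
Proof.
move=> [JI [x xJ]]; have [v [Pv vJ] vv] := exists_vertex irr JI xJ.
exists v => //; apply/fintype.subsetP => j jJ; apply/activeP; split; last exact: vJ.
exact: fintype.subsetP JI j jJ.
Qed.

Lemma faces_valid J : valid J -> (#|J| <= n)%N /\ faces P (n - #|J|) (tight J).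
Proof.
move=> vJ; have [v vv Jv] := valid_vertex vJ; split.
  by rewrite -(card_active vv) subset_leq_card.
split; last exact: has_dim_tight Jv.
by have [JI [x xJ]] := vJ; exact: (is_face_tight irr JI xJ).
Qed.

Lemma facesE k F : faces P k F -> exists J, [/\ valid J, F = tight J & k = (n - #|J|)%N].
Proof.
move=> [faceF dimF]; have [v [J [vv Jv FE]]] := face_tight faceF.
exists J; split=> //; last first.
  by apply: (has_dim_unique dimF); rewrite FE; exact: has_dim_tight Jv.
split; last by have [F0 _] := faceF; rewrite -FE.
by apply: fintype.subset_trans Jv _; apply/fintype.subsetP => j /activeP[].
Qed.

Lemma valid_mem J i : valid J -> i \in I -> tight J `<=` tight [set i]%SET -> i \in J.
Proof.
by move=> vJ iI sub; have [v vv Jv] := valid_vertex vJ; exact: tight_mem vv Jv iI sub.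
Qed.

End SimpleFaces.

(** * The halohedron *)

(** Antipodes in two different tubes are excluded by [clash] if the tubes are far apart, and by the
    larger tube alone if they are nested. *)
Lemma tubings_set n (T : {set {set pmn n}}) :
  @tubings n [set` T] <-> T \in tubings_in [set: pmn n]%SET.
Proof.
split=> [[tT c a]|/tubings_inP[tT _ c]].
  apply/tubings_inP; split=> // s t sT tT'.
  have := c s t sT tT'; rewrite /nested_or_far => /or3P[->//|->|/andP[dis /forall_inP nadj]].
    by rewrite orbT.
  apply/or3P; apply: Or33; apply/farP => u v us vt.
  rewrite /clash; apply/norP; split.
    by apply: contraTneq vt => ->; rewrite (disjointFr dis us).
  apply/norP; split; first by have /forall_inP := nadj u us; apply.
  by apply: contraTneq vt => ->; exact: (a s t u).
split=> // [s t sT tT'|s t u sT tT' us].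
  rewrite /weakly_compatible.
  case/or3P: (c s t sT tT') => [->//|->|/farP far]; first by rewrite orbT.
  apply/or3P; apply: Or33; apply/andP; split.
    rewrite disjoint_subset; apply/fintype.subsetP => u us; rewrite inE; apply/negP => ut.
    by have := far u u us ut; rewrite /clash eqxx.
  apply/forall_inP => u us; apply/forall_inP => v vt.
  by have := far u v us vt; rewrite /clash !negb_or => /and3P[].
have anti r : tube r -> u \in r -> antipode u \notin r.
  by case/and3P => _ _ /forall_inP; apply.
case/or3P: (c s t sT tT') => [/fintype.subsetP st|/fintype.subsetP ts|/farP far].
- by apply: anti (st u us); exact: tT.
- by apply: contra (anti s (tT s sT) us); exact: ts.
by apply/negP => at_; have := far u _ us at_; rewrite /clash eqxx !orbT.
Qed.

Lemma vertices_tubings n (t : {set pmn n}) : vertices (@tubings n) t <-> tube t.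
Proof.
split=> [[tT _ _]|tt]; first exact: tT.
split=> [_ ->//|_ _ -> ->|_ _ u -> ->]; first by rewrite /weakly_compatible subxx.
by case/and3P: tt => _ _ /forall_inP; apply.
Qed.

Lemma vertices_dual (R : realType) (d : nat) (P : set 'rV[R]_d) :
  vertices (dual_complex P) = facets P.
Proof.
apply/seteqP; split=> [F [sub _]|F fF]; first exact: sub.
split=> [_ ->//|]; have [k [_ [[[x Fx] [c FE]] _]]] := fF.
exists x; split; last by move=> _ ->.
by move: Fx; rewrite FE => -[].
Qed.

(** Faces are matched with valid index sets by [tight], and these with tubings by [phi], which sends
    an index to the tube of its facet. The number of tubes is the codimension. *)
Lemma nb_faces_halohedron (R : realType) (d n : nat) (P : set 'rV[R]_d) k :
  is_halohedron n P ->
  nb_faces P k = if (k <= n)%N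
    then #|[set T in tubings_in [set: pmn n] | #|T| == (n - k)%N]%SET| else 0%N.
Proof.
move=> [dimP [polyP simp] [f [fbij fK]]].
have [m [A [b [x0 [W [I irr]]]]]] := exists_irredundant polyP dimP.
have simpleP := simp n dimP.
pose tight := tight_face P A b; pose vld := valid P A b I.
have memJ J i : vld J -> i \in I -> tight J `<=` tight [set i]%SET -> i \in J.
  exact: (valid_mem irr dimP simpleP).
have sub1 (J : {set 'I_m}) i : i \in J -> tight J `<=` tight [set i]%SET.
  by move=> iJ x [Px xJ]; split=> // j /set1P->; exact: xJ.
pose D := [set J : {set 'I_m} | `[< vld J >] && (k == n - #|J|)%N]%SET.
(* [J] is recovered from its face as the set of all inequalities in [I] that are tight on it. *)
have tight_inj : {in [set` D] &, injective tight}.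
  have half (J J' : {set 'I_m}) : vld J -> vld J' -> tight J = tight J' -> J \subset J'.
    move=> vJ vJ' e; apply/fintype.subsetP => j jJ; apply: (memJ _ _ vJ').
      by have [JI _] := vJ; exact: (fintype.subsetP JI).
    by rewrite -e; exact: sub1.
  move=> J J'; rewrite !inE /= !inE => /andP[/asboolP vJ _] /andP[/asboolP vJ' _] e.
  by apply/eqP; rewrite finset.eqEsubset !half.
have -> : nb_faces P k = #|D|.
  apply: card_fset_set; suff -> : faces P k = [set tight J | J in [set` D]].
    by rewrite (card_eql (inj_card_eq tight_inj)) card_finset.
  apply/seteqP; split=> [F FF|F [J /=]].
    have [J [vJ FE kJ]] := facesE irr dimP simpleP FF.
    by exists J => //=; rewrite inE kJ eqxx andbT; apply/asboolP.
  rewrite inE => /andP[/asboolP vJ /eqP->] <-.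
  by have [] := faces_valid irr dimP simpleP vJ.
pose phi j := f (tight [set j]%SET).
have [fV fI fS] := fbij; rewrite vertices_dual in fV fI fS fK.
have facI j : j \in I -> facets P (tight [set j]%SET) by exact: (facet_tight irr dimP).
have phi_inj : {in I &, injective phi}.
  move=> i j iI jI /fI e; apply: (tight_face1_inj irr iI jI).
  by rewrite -/(tight _) e ?inE; [|exact: facI|exact: facI].
have vldE (J : {set 'I_m}) : J \subset I ->
    vld J <-> (phi @: J)%SET \in tubings_in [set: pmn n]%SET.
  move=> JI; pose S := [set tight [set j]%SET | j in [set` J]].
  have SP : S `<=` facets P.
    by move=> _ [j jJ <-]; apply: facI; exact: (fintype.subsetP JI).
  have imS : f @` S = [set` (phi @: J)%SET].
    apply/seteqP; split=> [_ [_ [j jJ <-] <-]|t /= /imsetP[j jJ ->]].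
      by apply/imsetP; exists j.
    by exists (tight [set j]%SET) => //; exists j.
  rewrite -tubings_set -imS -fK //; split=> [[_ [x [Px xJ]]]|[_ [x [Px xS]]]].
    split=> //; exists x; split=> // _ [j jJ <-]; split=> // i /set1P->; exact: xJ.
  split=> //; exists x; split=> // j jJ.
  by have [_] := xS _ (ex_intro2 _ _ j jJ erefl); apply; rewrite finset.set11.
have cardphi (J : {set 'I_m}) : J \subset I -> #|(phi @: J)%SET| = #|J|.
  move=> /fintype.subsetP JI; apply: card_in_imset => i j iJ jJ; apply: phi_inj; exact: JI.
case: leqP => kn; last first.
  apply: eq_card0 => J; rewrite !inE; apply/negP => /andP[_ /eqP]; lia.
rewrite -(card_in_imset (f := fun J : {set 'I_m} => (phi @: J)%SET) (D := D)); last first.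
  move=> J J'; rewrite !inE => /andP[/asboolP[JI _] _] /andP[/asboolP[J'I _] _] e.
  have half (J1 J2 : {set 'I_m}) : J1 \subset I -> J2 \subset I ->
      (phi @: J1)%SET = (phi @: J2)%SET -> J1 \subset J2.
    move=> /fintype.subsetP s1 /fintype.subsetP s2 e12; apply/fintype.subsetP => j jJ1.
    have : phi j \in (phi @: J2)%SET by rewrite -e12; apply/imsetP; exists j.
    by case/imsetP=> i iJ2 eji; rewrite (phi_inj j i (s1 j jJ1) (s2 i iJ2) eji).
  by apply/eqP; rewrite finset.eqEsubset (half J J') ?(half J' J).
apply: eq_card => T; rewrite [in RHS]inE; apply/imsetP/andP => [[J]|[TT /eqP cT]].
  rewrite inE => /andP[/asboolP vJ /eqP kJ] ->; have [JI _] := vJ.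
  have [cJ _] := faces_valid irr dimP simpleP vJ.
  by split; [apply/vldE | rewrite cardphi //; apply/eqP; lia].
(* Each tube of [T] has the form [phi j], because [f] maps the facets onto the tubes. *)
pose J := [set j in I | phi j \in T]%SET.
have JI : J \subset I by apply/fintype.subsetP => j; rewrite inE => /andP[].
have TE : T = (phi @: J)%SET.
  apply/setP => t; apply/idP/imsetP => [tT|[j]]; last by rewrite inE => /andP[_ ?] ->.
  have : vertices (@tubings n) t.
    by apply/vertices_tubings; case/tubings_inP: TT => h _ _; exact: h.
  move=> /fS[F /(facetE irr dimP)[j jI ->] tE].
  by exists j; rewrite // inE jI /phi tE.
have vJ : vld J by apply/vldE; rewrite -?TE.
exists J => //; rewrite inE; apply/andP; split; first exact/asboolP.
by rewrite -(cardphi J) // -TE cT; apply/eqP; lia.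
Qed.

Lemma coef_wt n (X : {set pmn n}) j :
  (wt X)`_j = #|[set T in tubings_in X | #|T| == j]%SET|%:R.
Proof.
rewrite /wt coef_sum -sum1_card natr_sum.
rewrite [RHS](eq_bigl (fun T => (T \in tubings_in X) && (#|T| == j))); last first.
  by move=> T; rewrite inE.
rewrite [RHS]big_mkcondr; apply: eq_bigr => T _.
by rewrite coefXn eq_sym; case: eqP.
Qed.

Theorem theorem6p1p11 (R : realType) (d : nat -> nat)
    (H : forall n : nat, set 'rV[R]_(d n))
    (halo : forall n : nat, is_halohedron n (H n)) :
  fps2_of (fun n k => (nb_faces (H n) k)%:R) =
    (1 + (2 + varx) * vary) /
      (2 * fps2_sqrt (1 - 2 * (2 + varx) * vary + varx ^+ 2 * vary ^+ 2))
    + 1 / 2.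
Proof.
rewrite -homog_tubing_series; apply: fpsP => n; apply: fpsP => k.
rewrite [LHS]/= (nb_faces_halohedron _ (halo n)) [RHS]/= coef_poly ltnS.
by case: ifP => // _; rewrite coef_wt.
Qed.
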